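(* Let $X$ be a $\mathcal{C}=(p_1,p_2,0,0\,;q)$ cookie random walk with $q\ge\frac{b}{b+1}$ and $\nu(p_1,p_2)=\frac1b$, where $\nu(p_1,p_2)$ denotes the largest positive eigenvalue of the matrix $$\begin{pmatrix}\frac{p_1}{b}+\frac{p_1p_2}{b}-\frac{2p_1p_2}{b^2} & \frac{p_1p_2}{b^2}\\ \frac{p_1+p_2}{b}-\frac{2p_1p_2}{b^2} & \frac{p_1p_2}{b^2}\end{pmatrix}.$$ Then $X$ is transient, yet almost surely $$\liminf_{n\to\infty}\frac{|X_n|}{n}=0.$$
   Context: Fix an integer $b\ge2$. $\mathbb{T}$ is the infinite rooted $b$-ary tree with root $o$; each vertex $x$ has $b$ sons, each $x\ne o$ has a father, and by convention the father of $o$ is $o$ itself. $|x|$ is the height of $x$ (distance to $o$). A cookie environment is a vector $\mathcal{C}=(p_1,\ldots,p_M\,;q)\in[0,1)^M\times(0,1)$ with $M\ge1$. A $\mathcal{C}$ cookie random walk is a process $X=(X_n)_{n\ge0}$ on $\mathbb{T}$ with $X_0=o$ such that, conditionally on $X_0,\ldots,X_n$, with $j=\#\{0\le k\le n: X_k=X_n\}$, $X_{n+1}$ is each given son of $X_n$ with probability $p_j/b$ if $j\le M$ and $q/b$ if $j>M$, and is the father of $X_n$ with probability $1-p_j$ if $j\le M$ and $1-q$ if $j>M$. The walk is transient if $\lim_{n\to\infty}|X_n|=+\infty$ almost surely. *)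

(* Defs.v *)
From HB Require Import structures.
From mathcomp Require Import all_boot all_order all_algebra.
From mathcomp Require Import all_classical all_reals all_analysis.

Set Implicit Arguments.
Unset Strict Implicit.
Unset Printing Implicit Defensive.

Import Order.TTheory GRing.Theory Num.Theory.
Import numFieldNormedType.Exports.

Local Open Scope classical_set_scope.
Local Open Scope ring_scope.

(* A vertex of the infinite rooted b-ary tree is the word spelling the path
   from the vertex up to the root: the sons of x are the words i :: x. *)
Definition tree (b : nat) : Type := seq 'I_b.

HB.instance Definition _ (b : nat) := Countable.on (tree b).
HB.instance Definition _ (b : nat) := isPointed.Build (tree b) [::].
HB.instance Definition _ (b : nat) := @isMeasurable.Build
  default_measure_display (tree b) discrete_measurable discrete_measurable0
  discrete_measurableC discrete_measurableU.

Definition root (b : nat) : tree b := [::].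

(* [behead [::] = [::]], so the father of the root is the root itself. *)
Definition father (b : nat) (x : tree b) : tree b := behead x.

Definition son (b : nat) (x : tree b) (i : 'I_b) : tree b := i :: x.

Definition height (b : nat) (x : tree b) : nat := size x.

Record cookies (R : realType) := Cookies {
  cookie_seq : seq R; (* p_1, ..., p_M *)
  cookie_end : R      (* q *)
}.

Definition is_cookie_env (R : realType) (C : cookies R) : Prop :=
  [/\ (0 < size (cookie_seq C))%N,
      (forall p, p \in cookie_seq C -> 0 <= p < 1) &
      0 < cookie_end C < 1].

(* p_j if j <= M and q if j > M, for j >= 1: the default value of [nth] is used
   exactly when M <= j - 1. *)
Definition cookie_strength (R : realType) (C : cookies R) (j : nat) : R :=
  nth (cookie_end C) (cookie_seq C) j.-1.

Definition visits (b : nat) (x : nat -> tree b) (n : nat) : nat :=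
  #|[set k : 'I_n.+1 | x k == x n]%SET|.

(* A son of x is never the father of x (also when x is the root), so the
   order of the two tests is irrelevant. *)
Definition step_prob (R : realType) (b : nat) (C : cookies R)
    (j : nat) (x y : tree b) : R :=
  if [exists i : 'I_b, y == son x i] then cookie_strength C j / b%:R
  else if y == father x then 1 - cookie_strength C j
  else 0.

(* The conditional law of X_{n+1} given X_0, ..., X_n is stated for each
   history x_0, ..., x_n, multiplied out by the probability of the history. *)
Definition is_cookie_walk (R : realType) (b : nat) (C : cookies R)
    (d : measure_display) (Omega : measurableType d) (P : probability Omega R)
    (X : nat -> {RV P >-> tree b}) : Prop :=
  (forall w, X 0%N w = root b) /\
  forall (n : nat) (x : nat -> tree b) (y : tree b),
    let history := [set w | forall k, (k <= n)%N -> X k w = x k] in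
    P (history `&` [set w | X n.+1 w = y]) =
      (P history * (step_prob C (visits x n) (x n) y)%:E)%E.

Definition is_transient (R : realType) (b : nat)
    (d : measure_display) (Omega : measurableType d) (P : probability Omega R)
    (X : nat -> {RV P >-> tree b}) : Prop :=
  {ae P, forall w, height (X n w) @[n --> \oo] --> \oo}.

Definition nu_matrix (R : realType) (b : nat) (p1 p2 : R) : 'M[R]_2 :=
  let B : R := b%:R in
  \matrix_(i < 2, j < 2)
    nth 0 (nth [::]
      [:: [:: p1 / B + p1 * p2 / B - 2 * p1 * p2 / B ^+ 2;
              p1 * p2 / B ^+ 2];
          [:: (p1 + p2) / B - 2 * p1 * p2 / B ^+ 2;
              p1 * p2 / B ^+ 2]] i) j.

Definition is_largest_positive_eigenvalue (R : realType) (n : nat)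
    (A : 'M[R]_n) (nu : R) : Prop :=
  [/\ 0 < nu, eigenvalue A nu &
      forall mu, 0 < mu -> eigenvalue A mu -> mu <= nu].

(* Main.v *)
Require Import Defs.
From mathcomp Require Import all_boot all_order all_algebra.
From mathcomp Require Import all_classical all_reals all_analysis.
From mathcomp Require Import ring lra zify.

Set Implicit Arguments.
Unset Strict Implicit.
Unset Printing Implicit Defensive.

Import Order.TTheory GRing.Theory Num.Theory.
Import numFieldNormedType.Exports.

Local Open Scope classical_set_scope.
Local Open Scope ring_scope.

(** The process of excursions. The visits of the walk to the subtree of a
    vertex consist of jumps at this vertex, separated by excursions into the
    subtrees of its sons. These subtrees do not interact, so the excursions
    can be postponed until the jumps at the vertex are known: if a vertex is
    visited [k] times from its father, then the numbers of jumps to its sons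
    are the types of the offspring of an individual of type [k] in a branching
    process with types in [nat] ([exck_branching_le], [exck_branching_ge]).

    Transience. Let [M] be the number of cookies. After its first [M] jumps at
    a vertex the walk is at least as likely to jump to a given son as to the
    father, so from type [k] the type of each son dominates the number [T] of
    tails before the [(k - M)]-th head of a fair coin. The expectation of
    ['C(T, M.+1)] is exactly ['C(k, M.+1)]; with two sons the total of this
    function is therefore doubled in mean at each generation, and a version of
    it that is constant for large [k] is a lower bound for the survival
    probability from type [k], up to a factor ([exck_le_death]). A vertex with
    many visits has two sons with many visits, and the extinction probability
    tends to 0 with the number of visits ([exck_vanish]): the walk cannot
    return to the root many times. The visits to the other levels are then
    bounded level by level ([tight_levels]).

    Speed zero. With the cookies [(p1, p2, 0, 0)] the first two visits to a
    vertex lead to at most two jumps to its sons, so that below a newly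
    discovered vertex only the types 1 and 2 occur, and the hypothesis on the
    eigenvalue is the criticality of this two-type process. It dies out
    ([critical_extinction]), that is, the excursion above a new vertex has a
    finite duration, but this duration has an infinite mean
    ([critical_tail_divergence]). Let [T_i] be the duration of the excursion
    above the first vertex visited at level [i]: it is independent of the past
    of the walk, and the sum over [i] of the probabilities of [T_i > K * i] is
    infinite for each [K]. Excursions above different levels may be nested,
    but if [T_i > K * i] and [T_j > K * j] with [i < j], then the first one
    has lasted at least [minn (K * i) (j - i - 1)] steps before the second one
    starts, and this is enough to bound the second moment of the number of
    such [i] by a multiple of the square of the first moment. Hence, whatever
    the past, the probability of a long excursion in the future is bounded
    below ([long_excursion_prob]), and almost surely [T_i > K * i] for
    infinitely many [i] ([never_long_vanish]). At the end of such an excursion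
    the walk is at level [i - 1] after more than [K * i] steps ([slow_times]).

    Events that depend on finitely many steps are handled through the
    averaging operator [expect] on functions of histories, which computes
    their probabilities ([prob_hist]). *)

(** * One step of the walk *)

Section Step.
Variables (R : realFieldType) (b : nat).

Lemma ler_indic (a c : bool) : (a -> c) -> a%:R <= c%:R :> R.
Proof. by case: a c => [] [] // /(_ isT). Qed.

Definition avg (p : R) (up : 'I_b -> R) (down : R) : R :=
  p / b%:R * (\sum_i up i) + (1 - p) * down.

Lemma avg_le p (f f' : 'I_b -> R) g g' : 0 <= p <= 1 ->
  (forall i, f i <= f' i) -> g <= g' -> avg p f g <= avg p f' g'.
Proof.
move=> /andP[p0 p1] ff' gg'; apply: lerD.
  by apply: ler_wpM2l; [rewrite divr_ge0 | apply: ler_sum].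
by apply: ler_wpM2l => //; rewrite subr_ge0.
Qed.

Lemma avg_const p c : (0 < b)%N -> avg p (fun=> c) c = c.
Proof.
move=> b0; rewrite /avg sumr_const card_ord.
have b1 : b%:R != 0 :> R by rewrite pnatr_eq0 -lt0n.
by rewrite -[X in _ * X]mulr_natl; field.
Qed.

Lemma avg_lin p a c (f f' : 'I_b -> R) g g' :
  avg p (fun i => a * f i + c * f' i) (a * g + c * g') =
  a * avg p f g + c * avg p f' g'.
Proof. by rewrite /avg big_split /= -!mulr_sumr; ring. Qed.

Lemma avg_scale p a (f : 'I_b -> R) g :
  avg p (fun i => a * f i) (a * g) = a * avg p f g.
Proof. by rewrite /avg -mulr_sumr; ring. Qed.

Lemma avg_ge0 p (f : 'I_b -> R) g : 0 <= p <= 1 ->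
  (forall i, 0 <= f i) -> 0 <= g -> 0 <= avg p f g.
Proof.
move=> p01 f0 g0; have := @avg_le p (fun=> 0) f 0 g p01 f0 g0.
by rewrite {1}/avg big1 // !mulr0 addr0.
Qed.

Lemma avg_swap p q (f : 'I_b -> 'I_b -> R) (g f0 : 'I_b -> R) g0 :
  avg p (fun i => avg q (f i) (g i)) (avg q f0 g0) =
  avg q (fun j => avg p (f^~ j) (f0 j)) (avg p g g0).
Proof.
rewrite /avg !big_split /= -!mulr_sumr exchange_big /=; ring.
Qed.

Lemma avg_pick p i x y g : (0 < b)%N ->
  avg p (fun j => if j == i then x else y) g =
  p * (x / b%:R + (1 - b%:R^-1) * y) + (1 - p) * g.
Proof.
move=> b0; have b1 : b%:R != 0 :> R by rewrite pnatr_eq0 -lt0n.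
rewrite /avg (bigD1 i) //= eqxx.
under eq_bigr => j /negbTE -> do idtac.
rewrite sumr_const (_ : #|_| = b.-1)%N; last first.
  have := cardC1 i; rewrite card_ord => <-.
  by apply: eq_card => j; rewrite !inE.
by rewrite -[y *+ _]mulr_natl -subn1 natrB //; field.
Qed.

End Step.

(** * Excursions below a vertex *)

Section Environments.
Variable b : nat.
Implicit Types (w : seq 'I_b) (i j : 'I_b).

(** A configuration of the subtree below some vertex z: how many times the walk
    has left each vertex [w ++ z], as a function of [w]. *)
Definition env := seq 'I_b -> nat.
Implicit Types e : env.

Definition bump e w : env := fun w' => (e w' + (w' == w))%N.

Definition fresh : env := fun=> 0%N.

(** [subenv] and [graft] extract and replace the part of a configuration that
    lies below the son [i]. Positions are words read upwards, so the son through
    which the top of the subtree sees [w] is the last letter of [w]. *)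
Definition subenv e i : env := fun w => e (rcons w i).

Definition graft e i e1 : env := fun w =>
  if w is x :: s then if last x s == i then e1 (belast x s) else e w
  else e [::].

Lemma graft_rcons e i e1 w j :
  graft e i e1 (rcons w j) = if j == i then e1 w else e (rcons w j).
Proof.
case: w => [|x s] /=; first by [].
by rewrite last_rcons belast_rcons.
Qed.

Lemma env_eqP e e' :
  e [::] = e' [::] -> (forall w i, e (rcons w i) = e' (rcons w i)) -> e = e'.
Proof. by move=> e0 e1; apply/funext; elim/last_ind. Qed.

Lemma graft_id e i : graft e i (subenv e i) = e.
Proof. by apply: env_eqP => // w j; rewrite graft_rcons;
  case: eqP => // ->. Qed.

Lemma subenv_graft e i e1 j :
  subenv (graft e i e1) j = if j == i then e1 else subenv e j.
Proof. by apply/funext => w; rewrite /subenv graft_rcons; case: eqP. Qed.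

Lemma subenv_bump e w i : subenv (bump e (rcons w i)) i = bump (subenv e i) w.
Proof. by apply/funext => w'; rewrite /subenv /bump eqseq_rcons eqxx andbT. Qed.

Lemma subenv_bump0 e i : subenv (bump e [::]) i = subenv e i.
Proof.
by apply/funext => w; rewrite /subenv /bump; case: w => [|x s]; rewrite addn0.
Qed.

Lemma graft_bump e w i e1 : graft (bump e (rcons w i)) i e1 = graft e i e1.
Proof.
apply: env_eqP => [|w' j].
  by rewrite /= /bump; case: w => [|x s]; rewrite addn0.
by rewrite !graft_rcons /bump eqseq_rcons; case: eqP => //; rewrite andbF addn0.
Qed.

End Environments.
Arguments fresh {b}.

Section Excursions.
Variables (R : realFieldType) (b : nat) (str : nat -> R).
Hypothesis b_gt0 : (0 < b)%N.
Hypothesis str01 : forall j, 0 <= str j <= 1.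
Local Notation env := (env b).
Implicit Types (e : env) (w : seq 'I_b) (phi : env -> R).

(** The expectation of [phi] at the configuration left behind when the walk
    steps from the top of the subtree to its father, on the event that this
    takes at most [n] steps from the relative position [w]. *)
Fixpoint exc n phi e w : R :=
  if n is n'.+1 then
    avg (str (e w).+1) (fun i => exc n' phi (bump e w) (i :: w))
      (if w is _ :: w' then exc n' phi (bump e w) w' else phi (bump e w))
  else 0.

Lemma exc_ge0 n phi e w : (forall e', 0 <= phi e') -> 0 <= exc n phi e w.
Proof.
move=> phi0; elim: n e w => [//|n IH] e w /=.
by apply: avg_ge0 => //; case: w.
Qed.

Lemma exc_le n phi phi' e w :
  (forall e', phi e' <= phi' e') -> exc n phi e w <= exc n phi' e w.
Proof.
move=> le_phi; elim: n e w => [//|n IH] e w /=.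
by apply: avg_le => //; case: w.
Qed.

Lemma exc_leS n phi e w :
  (forall e', 0 <= phi e') -> exc n phi e w <= exc n.+1 phi e w.
Proof.
move=> phi0; elim: n e w => [|n IH] e w; first exact: (@exc_ge0 1).
by apply: avg_le => //; case: w.
Qed.

Lemma exc_leW n n' phi e w : (n <= n')%N ->
  (forall e', 0 <= phi e') -> exc n phi e w <= exc n' phi e w.
Proof.
move=> nn' phi0; rewrite -(subnK nn'); elim: (n' - n)%N => [//|k IH].
by rewrite addSn; apply: (le_trans IH); apply: exc_leS.
Qed.

Lemma exc_le1 n phi e w : (forall e', phi e' <= 1) -> exc n phi e w <= 1.
Proof.
move=> phi1; elim: n e w => [|n IH] e w /=; first exact: ler01.
rewrite -[leRHS](avg_const (str (e w).+1) 1 b_gt0).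
by apply: avg_le => //; case: w.
Qed.

Lemma exc_avg n p (f : 'I_b -> env -> R) g e w :
  exc n (fun e' => avg p (f^~ e') (g e')) e w =
  avg p (fun i => exc n (f i) e w) (exc n g e w).
Proof.
elim: n e w => [|n IH] e w /=; first by rewrite /avg big1 // !mulr0 addr0.
rewrite -avg_swap; congr avg; first by apply/funext => i; rewrite IH.
by case: w.
Qed.

Lemma exc_scale n c phi e w :
  exc n (fun e' => c * phi e') e w = c * exc n phi e w.
Proof.
elim: n e w => [|n IH] e w /=.
  by rewrite mulr0.
rewrite -avg_scale; congr avg; first by apply/funext => i; rewrite IH.
by case: w.
Qed.

(** Strong Markov property at the exit from the subtree of a child [i]: what
    happens inside only sees and only changes the part of the configuration
    below [i]. *)
Lemma exc_child_le n phi e w i : (forall e', 0 <= phi e') ->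
  exc n phi e (rcons w i) <=
  exc n (fun e1 => exc n phi (graft e i e1) [::]) (subenv e i) w.
Proof.
move=> phi0; elim: n e w => [//|n IH] e w.
have le_exc m e' w' : (exc m (fun e1 => exc n phi (graft e' i e1) [::]) e' w'
    <= exc m (fun e1 => exc n.+1 phi (graft e' i e1) [::]) e' w').
  by apply: exc_le => e1; apply: exc_leS.
rewrite [leLHS]/= [leRHS]/=; apply: avg_le => // [j|].
  rewrite -rcons_cons; apply: (le_trans (IH _ _)).
  rewrite subenv_bump; apply: exc_le => e1.
  by rewrite graft_bump; apply: exc_leS.
case: w => [|x w] /=.
  rewrite -[in leLHS](graft_id (bump e [:: i]) i).
  rewrite -[[:: i]]/(rcons [::] i) subenv_bump graft_bump.
  by apply: (@exc_leS n).
apply: (le_trans (IH _ _)).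
rewrite -rcons_cons subenv_bump; apply: exc_le => e1.
by rewrite graft_bump; apply: exc_leS.
Qed.

Lemma exc_child_ge n m phi e w i : (forall e', 0 <= phi e') ->
  exc n (fun e1 => exc m phi (graft e i e1) [::]) (subenv e i) w <=
  exc (n + m) phi e (rcons w i).
Proof.
move=> phi0; elim: n e w => [|n IH] e w; first exact: exc_ge0.
rewrite addSn [leLHS]/= [leRHS]/=; apply: avg_le => // [j|].
  rewrite -rcons_cons; apply: le_trans (IH _ _).
  by rewrite subenv_bump; apply: exc_le => e1; rewrite graft_bump.
case: w => [|x w] /=.
  rewrite -[in leRHS](graft_id (bump e [:: i]) i).
  rewrite -[[:: i]]/(rcons [::] i) subenv_bump graft_bump.
  by apply: exc_leW => //; apply: leq_addl.
apply: le_trans (IH _ _).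
by rewrite -rcons_cons subenv_bump; apply: exc_le => e1; rewrite graft_bump.
Qed.

End Excursions.

(** * Branching *)

Section Branching.
Variables (R : realFieldType) (b : nat) (str : nat -> R).
Hypothesis b_gt0 : (0 < b)%N.
Hypothesis str01 : forall j, 0 <= str j <= 1.
Local Notation env := (env b).
Local Notation exc := (exc str).
Implicit Types (e : env) (l : 'I_b -> nat) (H : ('I_b -> nat) -> R).

Definition incr l i : 'I_b -> nat := fun j => (l j + (j == i))%N.

Lemma incrC l i j : incr (incr l i) j = incr (incr l j) i.
Proof. by apply/funext => k; rewrite /incr addnAC. Qed.

(** What happens at a single vertex that the walk has left [v] times so far:
    the expectation of [H] at the numbers of jumps to each child ([l] initially)
    when the walk has jumped [k] more times to the father, with a limit of [m]
    jumps. The walk may make excursions in between, so these jumps are not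
    consecutive steps. *)
Fixpoint loc m v k l H {struct m} : R :=
  if k is k'.+1 then
    if m is m'.+1 then
      avg (str v.+1) (fun i => loc m' v.+1 k (incr l i) H) (loc m' v.+1 k' l H)
    else 0
  else H l.

Lemma loc0 m v l H : loc m v 0 l H = H l.
Proof. by case: m. Qed.

Lemma loc_ge0 m v k l H : (forall l', 0 <= H l') -> 0 <= loc m v k l H.
Proof.
by move=> H0; elim: m v k l => [|m IH] v [|k] l //=; apply: avg_ge0.
Qed.

Lemma loc_le m v k l H H' :
  (forall l', H l' <= H' l') -> loc m v k l H <= loc m v k l H'.
Proof.
by move=> leH; elim: m v k l => [|m IH] v [|k] l //=; apply: avg_le.
Qed.

Lemma loc_leW m m' v k l H : (m <= m')%N ->
  (forall l', 0 <= H l') -> loc m v k l H <= loc m' v k l H.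
Proof.
move=> + H0; elim: m m' v k l => [|m IH] m' v [|k] l; rewrite ?loc0 //.
  by move=> _; apply: loc_ge0.
by case: m' => // m'; rewrite ltnS => mm' /=; apply: avg_le => // *; apply: IH.
Qed.

Lemma loc_lin m v k l a c H H' :
  loc m v k l (fun l' => a * H l' + c * H' l') =
  a * loc m v k l H + c * loc m v k l H'.
Proof.
elim: m v k l => [|m IH] v [|k] l //=; first by rewrite !mulr0 addr0.
rewrite IH -avg_lin; congr avg; apply/funext => i; exact: IH.
Qed.

Lemma loc_incr m v k l i H :
  loc m v k (incr l i) H = loc m v k l (fun l' => H (incr l' i)).
Proof.
elim: m v k l => [|m IH] v [|k] l //=; rewrite IH; congr avg.
by apply/funext => j; rewrite incrC IH.
Qed.

Lemma exc_loc n m v k l (H : env -> ('I_b -> nat) -> R) e w :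
  exc n (fun e1 => loc m v k l (H e1)) e w =
  loc m v k l (fun l' => exc n (H^~ l') e w).
Proof.
elim: m v k l => [|m IH] v [|k] l //=.
  have := @exc_scale _ _ str n 0 (fun=> 0) e w.
  by under eq_fun do rewrite mul0r; rewrite mul0r.
rewrite exc_avg IH; congr avg; by apply/funext => i; rewrite IH.
Qed.

(** The probability that each of the next [k] visits to the subtree ends within
    [n] steps. *)
Fixpoint exck n k e : R :=
  if k is k'.+1 then exc n (exck n k') e [::] else 1.

Lemma exck_ge0 n k e : 0 <= exck n k e.
Proof. by elim: k e => [|k IH] e //=; apply: exc_ge0. Qed.

Lemma exck_le1 n k e : exck n k e <= 1.
Proof. by elim: k e => [|k IH] e //=; apply: exc_le1. Qed.

Lemma exck_leS n k e : exck n k.+1 e <= exck n k e.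
Proof.
elim: k e => [|k IH] e /=; first exact: exc_le1.
by apply: exc_le => // e'; apply: IH.
Qed.

Lemma exck_anti n k k' e : (k <= k')%N -> exck n k' e <= exck n k e.
Proof.
move=> kk'; rewrite -(subnK kk'); elim: (k' - k)%N => [//|d IH].
by rewrite addSn; apply: le_trans IH; apply: exck_leS.
Qed.

Lemma exck_leW n n' k e : (n <= n')%N -> exck n k e <= exck n' k e.
Proof.
move=> nn'; elim: k e => [//|k IH] e /=.
apply: (@le_trans _ _ (exc n (exck n' k) e [::])); first exact: exc_le.
by apply: exc_leW => // e'; apply: exck_ge0.
Qed.

Definition offspring n e l : R := \prod_(i < b) exck n (l i) (subenv e i).

Lemma offspring_ge0 n e l : 0 <= offspring n e l.
Proof. by apply: prodr_ge0 => i _; apply: exck_ge0. Qed.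

Lemma exc_offspring n e i l :
  exc n (fun e1 => offspring n (graft e i e1) l) (subenv e i) [::] =
  offspring n e (incr l i).
Proof.
pose c := \prod_(j < b | j != i) exck n (l j) (subenv e j).
rewrite [RHS](bigD1 i) //= /incr eqxx addn1 /=.
rewrite [X in _ * X](_ : _ = c); last first.
  by apply: eq_bigr => j /negbTE ->; rewrite addn0.
rewrite mulrC -exc_scale; congr exc; apply/funext => e1.
rewrite /offspring (bigD1 i) //= subenv_graft eqxx mulrC; congr (_ * _).
by apply: eq_bigr => j /negbTE ji; rewrite subenv_graft ji.
Qed.


Lemma offspring_bump n e l : offspring n (bump e [::]) l = offspring n e l.
Proof. by apply: eq_bigr => i _; rewrite subenv_bump0. Qed.

Lemma offspring0 n e : offspring n e (fun=> 0%N) = 1.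
Proof. exact: big1. Qed.

(** Each jump to a child [i] lengthens by one the list of excursions to be made
    below [i]; since the subtrees of the children do not interact, these
    excursions can be postponed until all jumps out of the vertex are known.
    Limiting the time in different ways on the two sides turns this identity
    into a pair of inequalities. *)
Lemma exck_branching_le n k e :
  exck n.+1 k e <= loc (k * n.+1) (e [::]) k (fun=> 0%N) (offspring n e).
Proof.
have exc_le_loc k' : (forall e, exck n.+1 k' e <=
      loc (k' * n.+1) (e [::]) k' (fun=> 0%N) (offspring n e)) ->
    forall n' e, (n' <= n.+1)%N -> exc n' (exck n.+1 k') e [::] <=
      loc (n' + k' * n.+1) (e [::]) k'.+1 (fun=> 0%N) (offspring n e).
  move=> IHk; elim=> [|n' IH] e' n'n.
    by apply: loc_ge0 => l; apply: offspring_ge0.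
  have bump0 : bump e' [::] [::] = (e' [::]).+1 by rewrite /bump addn1.
  have ge0 e1 : 0 <= exck n.+1 k' e1 by apply: exck_ge0.
  rewrite addSn [leLHS]/= [leRHS]/=; apply: avg_le => // [i|].
    apply: (le_trans (exc_child_le str01 n' (bump e' [::]) [::] i ge0)).
    rewrite subenv_bump0 loc_incr.
    pose L := (n' + k' * n.+1)%N.
    apply: (@le_trans _ _ (exc n (fun e1 => loc L (e' [::]).+1 k'.+1
        (fun=> 0%N) (offspring n (graft e' i e1))) (subenv e' i) [::])).
      apply: (@le_trans _ _ (exc n' (fun e1 => loc L (e' [::]).+1 k'.+1
          (fun=> 0%N) (offspring n (graft e' i e1))) (subenv e' i) [::])).
        apply: exc_le => // e1; apply: (le_trans (IH _ (ltnW n'n))).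
        rewrite /= bump0; apply: loc_le => // l.
        rewrite -[_ e' [::]]/(bump e' [::]).
        by rewrite /offspring; apply: ler_prod => j _; rewrite exck_ge0 //=
          !subenv_graft subenv_bump0.
      apply: exc_leW => // e1; apply: loc_ge0 => // l.
      exact: offspring_ge0.
    by rewrite exc_loc; apply: loc_le => // l; rewrite exc_offspring.
  apply: (le_trans (IHk _)); rewrite bump0.
  apply: (@le_trans _ _ (loc (k' * n.+1) (e' [::]).+1 k' (fun=> 0%N)
    (offspring n e'))).
    by apply: loc_le => // l; rewrite offspring_bump.
  by apply: loc_leW => // [|l]; rewrite ?offspring_ge0 ?leq_addl.
elim: k e => [|k IHk] e; first by rewrite loc0 offspring0.
by rewrite mulSn; apply: exc_le_loc.
Qed.

Lemma exck_branching_ge n m N k e : (m * n.+1 <= N)%N ->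
  loc m (e [::]) k (fun=> 0%N) (offspring n e) <= exck N k e.
Proof.
move=> mN; have loc_le_exc m' k' : (m' <= m)%N -> forall e,
    loc m' (e [::]) k'.+1 (fun=> 0%N) (offspring n e) <=
    exc (m' * n.+1) (exck N k') e [::].
  elim: m' k' => [|m' IH] k' m'm e' //.
  have bump0 : bump e' [::] [::] = (e' [::]).+1 by rewrite /bump addn1.
  have ge0 e1 : 0 <= exck N k' e1 by apply: exck_ge0.
  rewrite mulSn addSn [leLHS]/= [leRHS]/=; apply: avg_le => // [i|].
    apply: (le_trans _ (exc_child_ge str01 n _ (bump e' [::]) [::] i ge0)).
    rewrite subenv_bump0 loc_incr.
    apply: (@le_trans _ _ (exc n (fun e1 => loc m' (e' [::]).+1 k'.+1
        (fun=> 0%N) (offspring n (graft e' i e1))) (subenv e' i) [::])).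
      by rewrite exc_loc; apply: loc_le => // l; rewrite exc_offspring.
    apply: exc_le => // e1; apply: le_trans (IH _ (ltnW m'm) _).
    rewrite /= bump0; apply: loc_le => // l.
    by rewrite /offspring; apply: ler_prod => j _; rewrite exck_ge0 //=
      !subenv_graft subenv_bump0.
  case: k' ge0 => [|k'] ge0; first by rewrite loc0 offspring0.
  apply: (@le_trans _ _ (loc m' (bump e' [::] [::]) k'.+1 (fun=> 0%N)
    (offspring n (bump e' [::])))).
    by rewrite bump0; apply: loc_le => // l; rewrite offspring_bump.
  apply: (le_trans (IH _ (ltnW m'm) _)); rewrite [leRHS]/=.
  apply: exc_leW => // [|e1]; last exact: exck_ge0.
  by apply: leq_trans mN; rewrite leq_mul2r ltnW ?orbT.
case: k => [|k]; first by rewrite loc0 offspring0.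
apply: (le_trans (loc_le_exc _ _ (leqnn _) _)).
by apply: exc_leW => // e1; apply: exck_ge0.
Qed.

End Branching.

(** * A fair race *)

Section Race.
Variable R : realType.
Implicit Types (psi : nat -> R).

(** A fair coin is tossed, at most [m] times, until the [j]-th head; this is the
    expectation of [psi] at [l] plus the number of tails. *)
Fixpoint race m j l psi {struct m} : R :=
  if j is j'.+1 then
    if m is m'.+1 then (race m' j' l psi + race m' j l.+1 psi) / 2 else 0
  else psi l.

Lemma race0 m l psi : race m 0 l psi = psi l.
Proof. by case: m. Qed.

Lemma race_ge0 m j l psi : (forall l', 0 <= psi l') -> 0 <= race m j l psi.
Proof.
by move=> p0; elim: m j l => [|m IH] [|j] l //=; rewrite divr_ge0 ?addr_ge0.
Qed.

Lemma race_le m j l psi psi' :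
  (forall l', psi l' <= psi' l') -> race m j l psi <= race m j l psi'.
Proof.
move=> lep; elim: m j l => [|m IH] [|j] l //=.
by rewrite ler_pM2r ?invr_gt0 ?ltr0n // lerD.
Qed.

Lemma race_leW m m' j l psi : (m <= m')%N ->
  (forall l', 0 <= psi l') -> race m j l psi <= race m' j l psi.
Proof.
move=> + p0; elim: m m' j l => [|m IH] m' [|j] l; rewrite ?race0 //.
  by move=> _; apply: race_ge0.
case: m' => // m'; rewrite ltnS => mm' /=.
by rewrite ler_pM2r ?invr_gt0 ?ltr0n // lerD ?IH.
Qed.

Lemma race_lin m j l a c psi psi' :
  race m j l (fun l' => a * psi l' + c * psi' l') =
  a * race m j l psi + c * race m j l psi'.
Proof.
elim: m j l => [|m IH] [|j] l //=; first by rewrite !mulr0 addr0.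
rewrite !IH; lra.
Qed.

Lemma race_geom m j l : race m j l (fun l' => 2^-1 ^+ l') <=
  (2 / 3) ^+ j * 2^-1 ^+ l.
Proof.
elim: m j l => [|m IH] [|j] l; rewrite ?race0 ?expr0 ?mul1r //.
  by rewrite /= mulr_ge0 // exprn_ge0 // divr_ge0.
rewrite /= ler_pdivrMr ?ltr0n //; apply: (le_trans (lerD (IH _ _) (IH _ _))).
by rewrite !exprS; lra.
Qed.

Lemma race_cst_le m j l : race m j l (fun=> 1) <= 1.
Proof.
elim: m j l => [|m IH] [|j] l //=.
by rewrite ler_pdivrMr ?ltr0n // mul1r; apply: lerD.
Qed.

Section Antitone.
Variable psi : nat -> R.
Hypothesis psi_ge0 : forall l, 0 <= psi l.
Hypothesis psi_anti : forall l, psi l.+1 <= psi l.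

Lemma race_anti_tails m j l : race m j l.+1 psi <= race m j l psi.
Proof.
elim: m j l => [|m IH] [|j] l //=.
by rewrite ler_pM2r ?invr_gt0 ?ltr0n // lerD.
Qed.

Lemma race_anti_headsS m j l : race m j.+1 l psi <= race m j l psi.
Proof.
elim: m j l => [|m IH] [|j] l //=; rewrite ?race0 //.
  rewrite ler_pdivrMr ?ltr0n // mulrDr mulr1; apply: lerD => //.
  by apply: (le_trans (IH _ _)); rewrite race0.
by rewrite ler_pM2r ?invr_gt0 ?ltr0n // lerD.
Qed.

Lemma race_anti_heads m j j' l :
  (j <= j')%N -> race m j' l psi <= race m j l psi.
Proof.
move=> jj'; rewrite -(subnK jj'); elim: (j' - j)%N => [//|d IH].
by rewrite addSn; apply: le_trans IH; apply: race_anti_headsS.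
Qed.

End Antitone.

(** The expectation of ['C(l + T, n)], where [T] is the number of tails before
    the [j]-th head. *)
Fixpoint tails_bin n {struct n} : nat -> nat -> nat :=
  fix tails_bin_n j l {struct j} :=
    if n is n'.+1 then
      if j is j'.+1 then (tails_bin_n j' l + tails_bin n' j l)%N
      else 'C(l, n)
    else 1%N.

Lemma tails_bin_n0 j l : tails_bin 0 j l = 1%N.
Proof. by case: j. Qed.

Lemma tails_bin_0l n l : tails_bin n 0 l = 'C(l, n).
Proof. by case: n; rewrite ?bin0. Qed.

Lemma tails_binSS n j l :
  tails_bin n.+1 j.+1 l = (tails_bin n.+1 j l + tails_bin n j.+1 l)%N.
Proof. by []. Qed.

Lemma tails_bin_harmonic n j l :
  (tails_bin n j l + tails_bin n j.+1 l.+1 = 2 * tails_bin n j.+1 l)%N.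
Proof.
elim: n j l => [|n IH] j l; first by rewrite !tails_bin_n0.
have tails_binSr j' : tails_bin n.+1 j' l.+1 =
    (tails_bin n.+1 j' l + tails_bin n j' l)%N.
  elim: j' => [|j' IHj]; first by rewrite !tails_bin_0l binS.
  by rewrite !tails_binSS IHj; have := IH j' l; lia.
by rewrite tails_binSr tails_binSS; lia.
Qed.

(** Hence ['C(_, n)] is reproduced by a race with [n.-1] heads missing:
    the expectation of ['C(T, n)] is ['C(k, n)] when [j.+1 = k - n.-1]. *)
Lemma tails_bin_start n j : tails_bin n j.+1 0 = 'C(j + n, n).
Proof.
elim: n j => [|n IH] j; first by rewrite tails_bin_n0 bin0.
elim: j => [|j IHj]; rewrite tails_binSS.
  by rewrite tails_bin_0l bin0n IH !binn.
by rewrite IHj IH !addSn !addnS binS.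
Qed.

(** The moment is at most [t ^- n] times the moment of [(1 + t) ^ (l + T)];
    here [t = 1/4]. *)
Lemma tails_bin_bound n j l :
  (tails_bin n j l)%:R <= 4 ^+ n * ((4 / 3) ^+ j * (5 / 4) ^+ l) :> R.
Proof.
have ge0 a c : 0 <= (4 / 3) ^+ a * (5 / 4) ^+ c :> R.
  by rewrite mulr_ge0 // exprn_ge0 // divr_ge0.
elim: n j l => [|n IH] j l.
  rewrite tails_bin_n0 mul1r -[1](mulr1 1) ler_pM // exprn_ege1 //; lra.
elim: j => [|j IHj].
  rewrite tails_bin_0l expr0 mul1r; elim: l => [|l IHl].
    by rewrite bin0n mulr1 exprn_ge0.
  rewrite binS natrD; have := IH 0%N l; rewrite tails_bin_0l expr0 mul1r.
  move: IHl; rewrite !exprS; set x := 4 ^+ n; set y := _ ^+ l; lra.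
rewrite tails_binSS natrD; have := IH j.+1 l; move: IHj.
rewrite !exprS; set x := 4 ^+ n; set y := (5 / 4) ^+ l; set z := _ ^+ j; lra.
Qed.

(** [4 ^+ n * 2 ^+ j * (5 / 4) ^+ l] dominates the moment and decreases in mean
    by a factor [7 / 8] at each toss, so the last term of the left-hand side
    accounts for the limit on the number of tosses. *)
Lemma race_tails_bin m j l n eta psi : 0 <= eta -> (forall l, 0 <= psi l) ->
  (forall l, 'C(l, n)%:R - eta * 'C(l, n.+1)%:R <= psi l) ->
  (tails_bin n j l)%:R - eta * (tails_bin n.+1 j l)%:R -
    (7 / 8) ^+ m * (4 ^+ n * (2 ^+ j * (5 / 4) ^+ l)) <= race m j l psi.
Proof.
move=> eta0 psi0 le_psi.
have ge0 a c : 0 <= 4 ^+ n * (2 ^+ a * (5 / 4) ^+ c) :> R.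
  by rewrite !mulr_ge0 // exprn_ge0 // divr_ge0.
elim: m j l => [|m IH] [|j] l.
- rewrite race0 !tails_bin_0l expr0 mul1r; apply: le_trans (le_psi l).
  by rewrite lerBlDr lerDl.
- rewrite expr0 mul1r /race subr_le0 lerBlDr.
  apply: (le_trans (tails_bin_bound _ _ _)).
  apply: (@le_trans _ _ (4 ^+ n * (2 ^+ j.+1 * (5 / 4) ^+ l))); last first.
    by rewrite lerDl mulr_ge0.
  rewrite ler_pM2l ?exprn_gt0 // ler_pM2r ?exprn_gt0 ?divr_gt0 //.
  by rewrite lerXn2r ?nnegrE ?divr_ge0 //; lra.
- rewrite race0 !tails_bin_0l; apply: le_trans (le_psi l).
  by rewrite lerBlDr lerDl mulr_ge0 // exprn_ge0 // divr_ge0.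
have e n' : (tails_bin n' j.+1 l)%:R =
    ((tails_bin n' j l)%:R + (tails_bin n' j.+1 l.+1)%:R) / 2 :> R.
  by rewrite -natrD tails_bin_harmonic natrM mulrC mulKf ?pnatr_eq0.
rewrite [leRHS]/= (e n) (e n.+1); have := IH j l; have := IH j.+1 l.+1.
rewrite !exprS; set x := 4 ^+ n; set y := (5 / 4) ^+ l; set z := 2 ^+ j.
set t := _ ^+ m; lra.
Qed.

End Race.

(** * Survival of the branching process *)

Lemma geometric_small (R : realType) (c r eps : R) : 0 <= r < 1 -> 0 < eps ->
  exists k0, forall k, (k0 <= k)%N -> c * r ^+ k < eps.
Proof.
move=> /andP[r0 r1] eps0.
have := @cvg_geometric R c r; rewrite ger0_norm // => /(_ r1).
move=> /cvgrPdist_lt /(_ _ eps0)[k0 _ near0]; exists k0 => k kk0.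
have := near0 k kk0; rewrite /= sub0r normrN.
exact: le_lt_trans (ler_norm _).
Qed.

Section Survival.
Variables (R : realType) (b : nat) (str : nat -> R) (M : nat) (q : R).
Hypothesis b_gt1 : (1 < b)%N.
Hypothesis str01 : forall j, 0 <= str j <= 1.
Hypothesis str_end : forall j, (M < j)%N -> str j = q.
Hypothesis q_large : 1 - q <= q / b%:R.
Local Notation exck := (@exck R b str).

Let b_gt0 : (0 < b)%N. Proof. exact: ltnW. Qed.

(** After the first [M] jumps, a jump to a given child is at least as likely as
    a jump to the father, so the number of jumps to this child stochastically
    dominates the number of tails in a fair race; the first [M] jumps cost at
    most [M] heads. *)
Lemma loc_le_race m v k (l : 'I_b -> nat) i (psi : nat -> R) :
  (forall j, 0 <= psi j) -> (forall j, psi j.+1 <= psi j) ->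
  loc str m v k l (fun l' => psi (l' i)) <= race m (k - (M - v)) (l i) psi.
Proof.
move=> psi0 psiA; elim: m v k l => [|m IH] v [|k] l; rewrite ?loc0 ?race0 //.
  exact: race_ge0.
rewrite [leLHS]/=.
have le_tails l' : race m l' (l i).+1 psi <= race m l' (l i) psi.
  exact: race_anti_tails.
have [Mv|vM] := leqP M v; last first.
  have -> : (k.+1 - (M - v) = k - (M - v.+1))%N by lia.
  rewrite -[leRHS](avg_const (str v.+1) _ b_gt0); apply: avg_le => // [j|].
    apply: (le_trans (IH _ _ _)).
    apply: (@le_trans _ _ (race m (k.+1 - (M - v.+1)) (l i) psi)).
      by rewrite /incr; case: (i == j); rewrite ?addn1 ?addn0.
    apply: (@le_trans _ _ (race m (k - (M - v.+1)) (l i) psi)).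
      by apply: race_anti_heads => //; apply: leq_sub2r.
    exact: race_leW.
  by apply: (le_trans (IH _ _ _)); apply: race_leW.
rewrite str_end; last by rewrite ltnS.
have Mv0 : (M - v = 0)%N by lia.
have Mv1 : (M - v.+1 = 0)%N by lia.
pose A := race m k (l i) psi; pose B := race m k.+1 (l i).+1 psi.
have BA : B <= A.
  by apply: le_trans (le_tails _) _; apply: race_anti_headsS.
have q01 : 0 <= q <= 1 by have := str01 M.+1; rewrite str_end.
have b0 : b%:R != 0 :> R by rewrite pnatr_eq0 -lt0n.
apply: (@le_trans _ _ (avg q (fun j : 'I_b => if j == i then B else (A + B) / 2)
    A)).
  apply: avg_le => // [j|]; last first.
    by apply: (le_trans (IH _ _ _)); rewrite Mv1 subn0.
  apply: (le_trans (IH _ _ _)); rewrite Mv1 subn0 /incr eq_sym.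
  case: eqP => _; first by rewrite addn1.
  by rewrite addn0; apply: (@race_leW _ m m.+1).
rewrite Mv0 subn0 [leRHS]/= -/A -/B avg_pick //.
have -> : q * (B / b%:R + (1 - b%:R^-1) * ((A + B) / 2)) + (1 - q) * A =
    (A + B) / 2 + (A - B) / 2 * (1 - q - q / b%:R) by field.
have : 0 <= (A - B) / 2 * (q / b%:R - (1 - q)).
  by rewrite !mulr_ge0 // ?invr_ge0 ?subr_ge0.
by move: ((A - B) / 2) (q / b%:R) => x y; lra.
Qed.

(** Two children are enough, and [x y <= (x ^+ 2 + y ^+ 2) / 2] decouples
    them. *)
Lemma exck_le_race n m k (f : nat -> R) : (k * n.+1 <= m)%N ->
  (forall l, 0 <= f l <= 1) -> (forall l, f l.+1 <= f l) ->
  (forall l, exck n l fresh <= f l) ->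
  exck n.+1 k fresh <= race m (k - M) 0 (fun l => f l ^+ 2).
Proof.
move=> km f01 fA le_f.
apply: (le_trans (exck_branching_le str01 _ _ _)).
pose i0 : 'I_b := Ordinal b_gt0; pose i1 : 'I_b := Ordinal b_gt1.
have sq_ge0 l : 0 <= f l ^+ 2 by apply: sqr_ge0.
have sqA l : f l.+1 ^+ 2 <= f l ^+ 2.
  by rewrite lerXn2r ?nnegrE ?fA //; have /andP[] := f01 l.+1;
    have /andP[] := f01 l.
apply: (@le_trans _ _ (loc str (k * n.+1) (@fresh b [::]) k (fun=> 0%N)
    (fun l => 2^-1 * f (l i0) ^+ 2 + 2^-1 * f (l i1) ^+ 2))).
  apply: loc_le => // l.
  apply: (@le_trans _ _ (f (l i0) * f (l i1))); last first.
    rewrite -subr_ge0 (_ : _ - _ = 2^-1 * (f (l i0) - f (l i1)) ^+ 2).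
      by rewrite mulr_ge0 ?invr_ge0 ?sqr_ge0.
    by field.
  rewrite /offspring (bigD1 i0) //= (bigD1 i1) //= mulrA -[leRHS]mulr1.
  have ge0 n' l' e' : 0 <= exck n' l' e' by apply: exck_ge0.
  apply: ler_pM; rewrite ?mulr_ge0 ?prodr_ge0 //; last first.
    by apply: prodr_ile1 => j _; rewrite exck_ge0 ?exck_le1.
  by apply: ler_pM; rewrite ?exck_ge0 ?le_f.
rewrite loc_lin.
have le_race i : loc str (k * n.+1) (@fresh b [::]) k (fun=> 0%N)
    (fun l : 'I_b -> nat => f (l i) ^+ 2) <=
      race m (k - M) 0 (fun l => f l ^+ 2).
  have := @loc_le_race (k * n.+1) 0 k (fun=> 0%N) i (fun l => f l ^+ 2)
    sq_ge0 sqA.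
  rewrite subn0 => /le_trans; apply; exact: race_leW.
have := lerD (le_race i0) (le_race i1); lra.
Qed.

(** The survival probability from [k] visits is bounded below by a multiple of
    ['C(k, M.+1)] for small [k]: this function vanishes for [k <= M], and its
    expectation after a fair race with [k - M] heads is exactly ['C(k, M.+1)],
    so that having [b >= 2] children doubles it. The correction term makes the
    function reach a maximum, beyond which it is kept constant; [scale] is
    large enough for the correction to cost less than the factor 2 gains. *)
Let scale : R := (3 * M.+1 * M.+2)%:R.
Let eta : R := M.+1%:R / scale.
Let peak := (3 * M.+1 * M.+2 + M)%N.
Let bump_bin l : R := 'C(l, M.+1)%:R - eta * 'C(l, M.+2)%:R.

Let scale_gt0 : 0 < scale. Proof. by rewrite ltr0n. Qed.

Let eta_ge0 : 0 <= eta. Proof. by rewrite divr_ge0. Qed.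

Lemma mulr_bin_left l n :
  n.+1%:R * 'C(l, n.+1)%:R = (l%:R - n%:R) * 'C(l, n)%:R :> R.
Proof.
rewrite -natrM mul_bin_left natrM.
have [nl|ln] := leqP n l; first by rewrite natrB.
by rewrite bin_small // !mulr0.
Qed.

Let bump_binS l :
  bump_bin l.+1 - bump_bin l = 'C(l, M)%:R * (peak%:R - l%:R) / scale.
Proof.
rewrite /bump_bin !binS !natrD.
have -> : forall x y z : R, x + y - eta * (z + x) - (x - eta * z) =
  y - eta * x by move=> *; ring.
rewrite /eta mulrAC mulr_bin_left; rewrite -/scale; field.
by rewrite !lt0r_neq0 // ltr_wpDr.
Qed.

Let bump_bin_le l : (l < peak)%N -> bump_bin l <= bump_bin l.+1.
Proof.
move=> lt_l; rewrite -subr_ge0 bump_binS divr_ge0 ?mulr_ge0 ?subr_ge0 //.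
by rewrite ler_nat ltnW.
Qed.

Let bump_bin_ge l : (peak <= l)%N -> bump_bin l.+1 <= bump_bin l.
Proof.
move=> le_l; rewrite -subr_ge0 -opprB bump_binS -mulNr -mulrN.
by rewrite divr_ge0 ?mulr_ge0 // oppr_ge0 subr_le0 ler_nat.
Qed.

Let bump_bin_lower l : (l <= peak)%N ->
  'C(l, M.+1)%:R / M.+2%:R <= bump_bin l.
Proof.
move=> le_l; rewrite /bump_bin.
have -> : 'C(l, M.+2)%:R = (l%:R - M.+1%:R) * 'C(l, M.+1)%:R / M.+2%:R :> R.
  by rewrite -mulr_bin_left mulrC mulKf ?pnatr_eq0.
set C : R := 'C(l, M.+1)%:R.
have C0 : 0 <= C by [].
have -> : C - eta * ((l%:R - M.+1%:R) * C / M.+2%:R) =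
  C / M.+2%:R + C * M.+1%:R / M.+2%:R * ((scale + M.+1%:R - l%:R) / scale).
  by rewrite /eta -(natr1 M.+1); field; rewrite !lt0r_neq0 // ltr_wpDr.
rewrite lerDl mulr_ge0 ?divr_ge0 ?mulr_ge0 ?subr_ge0 //.
by rewrite -natrD ler_nat (leq_trans le_l) // /peak leq_add2l.
Qed.

Let bump_bin_gain l : (l <= peak)%N ->
  bump_bin l <= 3 / 2 * ('C(l, M.+1)%:R - eta * 'C(l.+1, M.+2)%:R).
Proof.
move=> le_l; have := bump_bin_lower le_l.
rewrite /bump_bin binS natrD; set C : R := 'C(l, M.+1)%:R.
have -> : C / M.+2%:R = 3 * eta * C.
  rewrite /eta /scale !natrM; field.
  by rewrite !lt0r_neq0 // ltr_wpDr.
set D : R := _%:R; move: (eta * D) (eta * C) => x y; lra.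
Qed.

Let bump_bin_small l : (l <= M)%N -> bump_bin l = 0.
Proof.
move=> lM; rewrite /bump_bin !bin_small ?ltnS ?mulr0 ?subr0 //.
exact: ltnW. Qed.

Let plateau l : R := bump_bin (minn l peak).

Let plateau_leS l : plateau l <= plateau l.+1.
Proof.
have [lt_l|le_l] := ltnP l peak; rewrite /plateau.
  by rewrite (minn_idPl (ltnW lt_l)) (minn_idPl lt_l) bump_bin_le.
by rewrite (minn_idPr le_l) (minn_idPr (leqW le_l)).
Qed.

Let plateau_ge l : bump_bin l <= plateau l.
Proof.
have [le_l|lt_l] := leqP l peak; rewrite /plateau.
  by rewrite (minn_idPl le_l).
rewrite (minn_idPr (ltnW lt_l)).
rewrite -(subnK (ltnW lt_l)); elim: (l - peak)%N => [//|d IH].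
by rewrite addSn; apply: le_trans IH; apply: bump_bin_ge; apply: leq_addl.
Qed.

Let plateau_ge0 l : 0 <= plateau l.
Proof.
by rewrite (le_trans _ (bump_bin_lower (geq_minr _ _))) // divr_ge0.
Qed.

Let top : R := bump_bin peak.

Let top_gt0 : 0 < top.
Proof.
rewrite (lt_le_trans _ (bump_bin_lower (leqnn _))) // divr_gt0 // ltr0n.
by rewrite bin_gt0 /peak -addn1 addnC leq_add2r.
Qed.

Let plateau_le l : plateau l <= top.
Proof.
have [le_l|lt_l] := leqP l peak; last by rewrite /plateau (minn_idPr (ltnW _)).
rewrite -(_ : plateau peak = top); last by rewrite /plateau minnn.
rewrite -(subnK le_l); elim: (peak - l)%N => [//|d IH].
by rewrite addSn; apply: (le_trans IH).
Qed.

Let death l : R := 1 - plateau l / (2 * top).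

Let death01 l : 2^-1 <= death l <= 1.
Proof.
rewrite /death; apply/andP; split; last first.
  by rewrite gerBl divr_ge0 ?mulr_ge0 // ltW.
rewrite lerBrDr -lerBrDl ler_pdivrMr ?mulr_gt0 //.
by have := plateau_le l; lra.
Qed.

Lemma exck_le_death n k : exck n k fresh <= death k.
Proof.
have death0 l : 0 <= death l by have /andP[+ _] := death01 l; apply: le_trans.
have deathA l : death l.+1 <= death l.
  by rewrite lerD2l lerN2 ler_pM2r ?invr_gt0 ?mulr_gt0.
elim: n k => [|n IH] k.
  case: k => [|k] /=; last exact: death0.
  by rewrite /death /plateau min0n bump_bin_small // mul0r subr0.
wlog le_k : k / (k <= peak)%N => [thesis|].
  have [/thesis//|lt_k] := leqP k peak.
  apply: (le_trans (exck_anti b_gt0 str01 _ _ (ltnW lt_k))).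
  rewrite (le_trans (thesis _ (leqnn _))) // /death /plateau minnn.
  by rewrite (minn_idPr (ltnW _)).
have [kM|Mk] := leqP k M.
  rewrite /death /plateau (minn_idPl le_k) bump_bin_small // mul0r subr0.
  exact: exck_le1.
pose c := 3 / 2 / (2 * top); pose j := (k - M)%N.
have c0 : 0 <= c by rewrite divr_ge0 ?divr_ge0 ?mulr_ge0 // ltW.
have jE : j = (k - M.+1).+1 by rewrite /j; lia.
have tE : (tails_bin M.+1 j 0)%:R - eta * (tails_bin M.+2 j 0)%:R =
    'C(k, M.+1)%:R - eta * 'C(k.+1, M.+2)%:R :> R.
  by rewrite jE !tails_bin_start (addnS _ M.+1) (subnK Mk).
set t := 'C(k, _)%:R - _ in tE.
pose B : R := 4 ^+ M.+1 * (2 ^+ j * (5 / 4) ^+ 0).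
have le_m m : (k * n.+1 <= m)%N ->
    exck n.+1 k fresh <= 1 - c * (t - (7 / 8) ^+ m * B).
  move=> km; apply: (le_trans (exck_le_race km _ deathA IH)).
    by move=> l; have /andP[_ ->] := death01 l; rewrite death0.
  apply: (@le_trans _ _ (race m j 0 (fun l => 1 * 1 + (- c) * plateau l))).
    (* [(1 - u) ^+ 2 <= 1 - 3 / 2 * u] because [0 <= u <= 1 / 2]. *)
    apply: race_le => l; rewrite /death /c.
    have u_le : plateau l / (2 * top) <= 2^-1.
      by rewrite ler_pdivrMr ?mulr_gt0 // mulrA mulVf ?mul1r ?plateau_le //
        pnatr_eq0.
    have u_ge : 0 <= plateau l / (2 * top) by rewrite divr_ge0 ?mulr_ge0 // ltW.
    rewrite mulNr -(mulrA (3 / 2)) [_^-1 * plateau l]mulrC.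
    move: (plateau l / _) u_le u_ge => u u_le u_ge.
    have : 0 <= u * (2^-1 - u) by rewrite mulr_ge0 ?subr_ge0.
    by rewrite expr2; lra.
  rewrite race_lin.
  have := race_tails_bin m j 0 eta_ge0 plateau_ge0 plateau_ge.
  rewrite tE -/B => /(ler_wpM2l c0).
  have := race_cst_le R m j 0; rewrite mulNr.
  by rewrite mul1r => h1 h2; apply: lerB.
(* The number of tosses is arbitrary, so the error term can be dropped. *)
have le_t : exck n.+1 k fresh <= 1 - c * t.
  apply/ler_addgt0Pr => eps eps0.
  have r01 : 0 <= (7 / 8 : R) < 1 by lra.
  have [m0 small] := geometric_small (c * B) r01 eps0.
  have := le_m (maxn m0 (k * n.+1)) (leq_maxr _ _).
  have := small (maxn m0 (k * n.+1)) (leq_maxl _ _).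
  move: (_ ^+ _) => z; rewrite (_ : c * (t - z * B) = c * t - c * B * z).
    by move: (c * t) (c * B * z) => x y; lra.
  by rewrite mulrBr (mulrC z B) (mulrA c B z).
apply: (le_trans le_t); rewrite lerD2l lerN2 /plateau (minn_idPl le_k).
rewrite ler_pdivrMr ?mulr_gt0 // (le_trans (bump_bin_gain le_k)) //.
have ct : c * (2 * top) = 3 / 2 by rewrite /c divfK // mulf_neq0 // lt0r_neq0.
by rewrite -/t (mulrAC c t) ct.
Qed.

(** From many visits, each of two sons gets many visits with high probability:
    if the probability of extinction from [K] visits is at most [a], then it is
    at most [a ^+ 2 + o(1)] from many visits. Starting from [a = 1/2] it tends
    to 0. *)
Lemma exck_vanish r : exists K, forall n, exck n K fresh <= r.+2%:R^-1.
Proof.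
elim: r => [|r [K IH]].
  exists peak => n; apply: (le_trans (exck_le_death _ _)).
  rewrite /death /plateau minnn -/top.
  rewrite (_ : 1 - _ = 2^-1) //; field; exact: lt0r_neq0.
pose a : R := r.+2%:R^-1.
have a01 : 0 <= a <= 1 by rewrite invr_ge0 ler0n invf_le1 ?ler1n ?ltr0n.
have eps0 : 0 < r.+3%:R^-1 - a ^+ 2.
  rewrite subr_gt0 exprVn ltf_pV2 ?posrE ?ltr0n ?exprn_gt0 ?ltr0n //.
  by rewrite -natrX ltr_nat -mulnn; lia.
have r01 : 0 <= (2 / 3 : R) < 1 by lra.
have [k0 small] := geometric_small (2 ^+ K) r01 eps0.
exists (k0 + M)%N => n.
apply: (le_trans (exck_leW str01 _ _ (leqnSn n))).
pose f l : R := if (l < K)%N then 1 else a.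
have f01 l : 0 <= f l <= 1 by rewrite /f; case: ifP; rewrite ?ler01 ?lexx.
apply: (le_trans (@exck_le_race n _ _ f (leqnn _) f01 _ _)).
- move=> l; rewrite /f; case: ltnP => [lK|_].
    by rewrite ltnW //.
  by case: ifP => // _; have /andP[] := a01.
- move=> l; rewrite /f; case: ltnP => lK; first exact: exck_le1.
  by apply: le_trans (IH n); apply: exck_anti.
rewrite addnK; set m := (_ * _)%N.
apply: (@le_trans _ _ (race m k0 0
    (fun l => a ^+ 2 * 1 + 2 ^+ K * 2^-1 ^+ l))).
  apply: race_le => l; rewrite mulr1 /f; case: ltnP => lK; last first.
    by rewrite lerDl mulr_ge0 // exprn_ge0.
  rewrite expr1n -[leLHS]add0r lerD ?sqr_ge0 //.
  rewrite exprVn ler_pdivlMr ?exprn_gt0 // mul1r.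
  by rewrite ler_eXn2l ?ltr1n // ltnW.
rewrite race_lin; have := small k0 (leqnn _).
have K0 : (0 : R) <= 2 ^+ K by rewrite exprn_ge0.
have := ler_wpM2l K0 (race_geom R m k0 0); rewrite mulr1.
have := ler_wpM2l (sqr_ge0 a) (race_cst_le R m k0 0); rewrite mulr1.
move=> h1 h2 h3; rewrite -[leRHS](subrK (a ^+ 2)) addrC; apply: lerD => //.
exact: le_trans h2 (ltW h3).
Qed.

End Survival.

(** * The critical two-type process *)

Section Critical.
Variables (R : realType) (b : nat) (str : nat -> R).
Hypothesis b_gt1 : (1 < b)%N.
Hypothesis str01 : forall j, 0 <= str j <= 1.
Hypothesis str3 : str 3 = 0.
Hypothesis str4 : str 4 = 0.
Local Notation p1 := (str 1).
Local Notation p2 := (str 2).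
Hypothesis p1_lt1 : p1 < 1.
Hypothesis p2_lt1 : p2 < 1.
Hypothesis critical : p1 * (1 - p2) + p1 * p2 / b%:R * (1 + p2 - p1 * p2) +
  2 * (p1 * p2 * (1 - b%:R^-1)) = 1.
Local Notation exck := (@exck R b str).

Let b_gt0 : (0 < b)%N. Proof. exact: ltnW. Qed.

(** One or two visits from the father use at most the four cookies [p1, p2, 0,
    0] of a vertex, and lead to at most two jumps to its sons: below a vertex
    of type 1 or 2 no type exceeds 2. *)
Let x n : R := exck n 1 fresh.
Let y n : R := exck n 2 fresh.

Let pair (x y : R) : R := y / b%:R + (1 - b%:R^-1) * (x * x).
Let f1 (x y : R) : R := (1 - p1) + p1 * (1 - p2) * x + p1 * p2 * pair x y.
Let f2 (x y : R) : R := (1 - p1) * (1 - p2) +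
  (p1 * (1 - p2) + (1 - p1) * p2) * x + p1 * p2 * pair x y.

Let offspring1 n i :
  offspring str n fresh (incr (fun=> 0%N) i : 'I_b -> nat) = x n.
Proof.
rewrite /offspring (bigD1 i) //= big1 ?mulr1 /incr ?eqxx //.
by move=> j /negbTE ->.
Qed.

Let offspring2 n i j :
  offspring str n fresh (incr (incr (fun=> 0%N) i) j : 'I_b -> nat) =
  if j == i then y n else x n * x n.
Proof.
rewrite /offspring (bigD1 i) //= /incr eqxx.
have [->|ji] := eqVneq j i.
  by rewrite big1 ?mulr1 ?eqxx //= => k /negbTE ->.
rewrite (bigD1 j) //= big1 ?mulr1 => [|k /andP[/negbTE -> /negbTE -> //]].
by rewrite (negbTE ji) eqxx.
Qed.

Let avg0 (f : 'I_b -> R) g : avg 0 f g = g.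
Proof. by rewrite /avg !mul0r add0r subr0 mul1r. Qed.

Let avgc p (c g : R) : avg p (fun _ : 'I_b => c) g = p * c + (1 - p) * g.
Proof.
have := @avg_pick _ _ p (Ordinal b_gt0) c c g b_gt0.
rewrite (_ : (fun j => _) = (fun=> c)); last by apply/funext => j; case: eqP.
by move=> ->; rewrite mulrBl mul1r [_^-1 * c]mulrC; congr (_ * _ + _); ring.
Qed.

Lemma loc_type1 m n :
  loc (b := b) str (m + 4) (@fresh b [::]) 1 (fun=> 0%N)
    (offspring str n fresh) =
  f1 (x n) (y n).
Proof.
rewrite addnC /= str3.
under eq_fun => i do (under eq_fun => j do rewrite avg0 ?loc0 offspring2).
under eq_fun => i do rewrite avg_pick // ?loc0 offspring1.
by rewrite avgc ?loc0 offspring0 /f1 /pair; ring.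
Qed.

Lemma loc_type2 m n :
  loc (b := b) str (m + 4) (@fresh b [::]) 2 (fun=> 0%N)
    (offspring str n fresh) =
  f2 (x n) (y n).
Proof.
rewrite addnC /= str3 str4.
under eq_fun => i do (under eq_fun => j do rewrite !avg0 ?loc0 offspring2).
under eq_fun => i do rewrite avg_pick // !avg0 ?loc0 offspring1.
rewrite avgc; under eq_fun => i do rewrite avg0 ?loc0 offspring1.
by rewrite avgc ?loc0 offspring0 /f2 /pair; ring.
Qed.

Let offspring_ge n (l : 'I_b -> nat) : 0 <= offspring str n fresh l.
Proof. exact: offspring_ge0. Qed.

Lemma x_le n : x n.+1 <= f1 (x n) (y n).
Proof.
apply: (le_trans (exck_branching_le str01 _ _ _)).
by rewrite -(loc_type1 (1 * n.+1)); apply: loc_leW => //; apply: leq_addr.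
Qed.

Lemma y_le n : y n.+1 <= f2 (x n) (y n).
Proof.
apply: (le_trans (exck_branching_le str01 _ _ _)).
by rewrite -(loc_type2 (2 * n.+1)); apply: loc_leW => //; apply: leq_addr.
Qed.

Lemma x_ge n : f1 (x n) (y n) <= x (4 * n.+1).
Proof. by rewrite -(loc_type1 0); apply: exck_branching_ge. Qed.

Lemma y_ge n : f2 (x n) (y n) <= y (4 * n.+1).
Proof. by rewrite -(loc_type2 0); apply: exck_branching_ge. Qed.

Let c : R := p1 * p2 / b%:R.
Let D : R := p1 * p2 * (1 - b%:R^-1).

(** The linear form of the left eigenvector of the mean matrix. *)
Let S (x y : R) : R := (1 - c) * (1 - x) + c * (1 - y).

(** Criticality is the cancellation of the linear terms. *)
Let S_step (s t : R) : S (f1 s t) (f2 s t) = S s t - D * (1 - s) ^+ 2.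
Proof.
pose K := p1 * (1 - p2) + c * (1 + p2 - p1 * p2) + 2 * D.
have -> : S (f1 s t) (f2 s t) = S s t - D * (1 - s) ^+ 2 + (1 - s) * (K - 1).
  by rewrite /K /S /f1 /f2 /pair /c /D; ring.
by rewrite (_ : K = 1) ?subrr ?mulr0 ?addr0.
Qed.

Let p01 i : 0 <= str i <= 1. Proof. exact: str01. Qed.

Let b_inv : 0 < (b%:R^-1 : R) <= 2^-1.
Proof.
by rewrite invr_gt0 ltr0n b_gt0 lef_pV2 ?posrE ?ltr0n // (ler_nat R 2).
Qed.

Let p12_gt0 : 0 < p1 * p2.
Proof.
have /andP[p1_ge0 _] := p01 1; have /andP[p2_ge0 _] := p01 2.
rewrite lt_neqAle mulr_ge0 // andbT eq_sym; apply/eqP => p12.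
move: critical; rewrite -mulrA p12 !mul0r mulr0 !addr0 mulrBr p12 mulr1 subr0.
by move: p1_lt1 => /[swap] ->; rewrite ltxx.
Qed.

Let p1_gt0 : 0 < p1.
Proof.
have /andP[p1_ge0 _] := p01 1; rewrite lt_neqAle p1_ge0 andbT eq_sym.
by apply: contraTneq p12_gt0 => ->; rewrite mul0r ltxx.
Qed.

Let c_bounds : 0 < c < 2^-1.
Proof.
have /andP[b0 b2] := b_inv; have /andP[p2_ge0 p2_le1] := p01 2.
have p12_lt1 : p1 * p2 < 1.
  apply: (@le_lt_trans _ _ p1) => //; rewrite -[leRHS]mulr1.
  by apply: ler_wpM2l; rewrite // ltW.
rewrite mulr_gt0 //=; apply: (@lt_le_trans _ _ b%:R^-1) => //.
by rewrite /c -[ltRHS]mul1r ltr_pM2r.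
Qed.

Let D_bounds : 0 < D <= 1.
Proof.
have /andP[b0 b2] := b_inv; rewrite mulr_gt0 //=; last first.
  by rewrite subr_gt0 (le_lt_trans b2) // invf_lt1 ?ltr1n ?ltr0n.
have /andP[_ p1_le1] := p01 1; have /andP[p2_ge0 p2_le1] := p01 2.
rewrite -[leRHS](mulr1 1) ler_pM ?(ltW p12_gt0) //.
- by rewrite subr_ge0 (le_trans b2) // invf_le1 ?ler1n ?ltr0n.
- by rewrite -[leRHS](mulr1 1) ler_pM // ltW.
Qed.

Let x_le1 n : x n <= 1. Proof. exact: exck_le1. Qed.
Let y_le1 n : y n <= 1. Proof. exact: exck_le1. Qed.
Let x_homo m n : (m <= n)%N -> x m <= x n. Proof. exact: exck_leW. Qed.

Let S_ge n : (1 - c) * (1 - x n) <= S (x n) (y n).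
Proof.
have /andP[c0 _] := c_bounds.
by rewrite lerDl mulr_ge0 ?subr_ge0 // ltW.
Qed.

Let S_next_le n :
  S (x (4 * n.+1)%N) (y (4 * n.+1)%N) <= S (x n) (y n) - D * (1 - x n) ^+ 2.
Proof.
have /andP[c0 c1] := c_bounds; have c1' : 0 < 1 - c by lra.
rewrite -S_step; apply: lerD; rewrite ler_pM2l // lerD2l lerN2.
- exact: x_ge.
- exact: y_ge.
Qed.

Let S_next_ge n : S (x n) (y n) - D * (1 - x n) ^+ 2 <= S (x n.+1) (y n.+1).
Proof.
have /andP[c0 c1] := c_bounds; have c1' : 0 < 1 - c by lra.
rewrite -S_step; apply: lerD; rewrite ler_pM2l // lerD2l lerN2.
- exact: x_le.
- exact: y_le.
Qed.

(** Extinction: [S] decreases by [D * (1 - x) ^+ 2] as the time increases, so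
    [1 - x] cannot stay away from 0. *)
Lemma critical_extinction eps : 0 < eps -> exists n, 1 - exck n 1 fresh < eps.
Proof.
move=> eps0; apply: contrapT => /forallNP noteps.
have u_ge n : eps <= 1 - x n by rewrite leNgt; apply/negP/noteps.
have /andP[c0 c1] := c_bounds; have /andP[D0 D1] := D_bounds.
have S_le k : exists n, S (x n) (y n) <= 1 - k%:R * (D * eps ^+ 2).
  elim: k => [|k [n IH]].
    exists 0%N; rewrite mul0r subr0 /S -[leRHS](subrK c) lerD //.
      rewrite -[leRHS]mulr1 ler_wpM2l ?gerBl ?exck_ge0 // subr_ge0.
      by rewrite ltW // (lt_trans c1) // invf_lt1 ?ltr1n ?ltr0n.
    by rewrite -[leRHS]mulr1 ler_wpM2l ?gerBl ?exck_ge0 // ltW.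
  exists (4 * n.+1)%N; apply: (le_trans (S_next_le n)).
  have : D * eps ^+ 2 <= D * (1 - x n) ^+ 2.
    by rewrite ler_pM2l // lerXn2r ?nnegrE ?(le_trans (ltW eps0)) ?u_ge // ltW.
  by rewrite -natr1; move: IH;
    move: (S _ _) (D * (1 - _) ^+ 2) (D * eps ^+ 2) => *; lra.
have De0 : 0 < D * eps ^+ 2 by rewrite mulr_gt0 ?exprn_gt0.
have [k k_gt] : exists k, 1 < k%:R * (D * eps ^+ 2).
  exists (Num.trunc (D * eps ^+ 2)^-1).+1.
  rewrite -ltr_pdivrMr // mul1r; exact: truncnS_gt.
have [n Sn] := S_le k; have := S_ge n; have := Sn.
have : 0 <= (1 - c) * (1 - x n).
  rewrite mulr_ge0 ?subr_ge0 //.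
  by rewrite ltW // (lt_trans c1) // invf_lt1 ?ltr1n ?ltr0n.
by move: k_gt; move: (k%:R * _) ((1 - c) * _) (S _ _) => *; lra.
Qed.

Let u_gt0 n : 0 < 1 - x n.
Proof.
elim: n => [|n IH]; first by rewrite /x /= subr0.
have := x_le n; rewrite /f1.
have /andP[c0 _] := c_bounds; have /andP[D0 _] := D_bounds.
have p12u : 0 < p1 * (1 - p2) * (1 - x n).
  by rewrite !mulr_gt0 // subr_gt0.
have x0 : 0 <= x n by apply: exck_ge0.
have : p1 * p2 * pair (x n) (y n) <= p1 * p2.
  rewrite -[leRHS]mulr1 ler_pM2l // /pair.
  have /andP[b0 b2] := b_inv.
  rewrite [leRHS](_ : 1 = 1 / b%:R + (1 - b%:R^-1) * (1 * 1)); last by ring.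
  apply: lerD; first by rewrite ler_pM2r.
  by rewrite ler_wpM2l ?ler_pM // subr_ge0 (le_trans b2) // invf_le1 ?ler1n
      ?ltr0n.
by move: p12u; rewrite mulrBr mulr1 [p1 * (1 - p2)]mulrBr mulr1; lra.
Qed.

(** Infinite mean: [1 - x n] is the tail of the duration of an excursion. Were
    it summable, the total decrease of [S] from a late time on would be at most
    half of its value, although [S] tends to 0. *)
Lemma critical_tail_divergence A :
  exists n, A <= \sum_(i < n) (1 - exck i 1 fresh).
Proof.
apply: contrapT => /forallNP bounded.
pose s n := \sum_(i < n) (1 - x i).
have s_le n : s n <= A by rewrite ltW // ltNge; apply/negP/bounded.
have /andP[c0 c1] := c_bounds; have /andP[D0 D1] := D_bounds.
have c1' : 0 < 1 - c by lra.
have hs : has_sup (range s).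
  by split; [exists (s 0%N), 0%N | exists A => _ [n _ <-]].
have eps0 : 0 < (1 - c) / 2 by lra.
have [_ [n0 _ <-] n0_gt] := sup_adherent eps0 hs.
have tail n : (n0 <= n)%N -> s n - s n0 <= (1 - c) / 2.
  move=> _; have := sup_upper_bound hs (ex_intro2 _ _ n I erefl).
  by move: n0_gt; move: (sup _) => t => *; lra.
have S_lower n : (n0 <= n)%N ->
    S (x n0) (y n0) - (1 - x n0) * (s n - s n0) <= S (x n) (y n).
  move=> n0n; rewrite -(subnK n0n); elim: (n - n0)%N => [|k IH].
    by rewrite add0n subrr mulr0 subr0.
  rewrite addSn; apply: le_trans (S_next_ge _).
  have -> : s (k + n0).+1 = s (k + n0)%N + (1 - x (k + n0)%N).
    by rewrite /s big_ord_recr.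
  set u := 1 - x (k + n0)%N; rewrite -/u in IH *.
  have u0 : 0 <= u by apply: ltW; apply: u_gt0.
  have uu : u <= 1 - x n0 by rewrite lerD2l lerN2 x_homo // leq_addl.
  have : D * u ^+ 2 <= (1 - x n0) * u.
    rewrite expr2 mulrA ler_wpM2r // -[leRHS]mul1r ler_pM // ltW //.
  rewrite (_ : _ * (_ + u - _) = (1 - x n0) * (s (k + n0)%N - s n0) +
    (1 - x n0) * u); last by ring.
  by move: IH; move: (_ * (_ - _)) (_ * u) (D * _) (S _ _) (S _ _) => *; lra.
have S_pos n : (n0 <= n)%N -> (1 - c) / 2 * (1 - x n0) <= S (x n) (y n).
  move=> n0n; apply: le_trans (S_lower n n0n).
  have := S_ge n0; have := ler_wpM2l (ltW (u_gt0 n0)) (tail n n0n).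
  rewrite [(1 - x n0) * (_ / 2)]mulrC mulrAC.
  by move: (_ * (s n - _)) ((1 - c) * _) (S _ _) => *; lra.
have eta0 : 0 < (1 - c) / 2 * (1 - x n0) / 2.
  by rewrite divr_gt0 // mulr_gt0 // u_gt0.
have [m m_lt] := critical_extinction eta0.
pose n := maxn m n0.
have un : 1 - x n <= 1 - x m by rewrite lerD2l lerN2 x_homo // leq_maxl.
have nN : (n <= 4 * n.+1)%N by apply: leq_trans (leqnSn n) (leq_pmull _ _).
have n0N : (n0 <= 4 * n.+1)%N by apply: leq_trans nN; apply: leq_maxr.
have := S_pos _ n0N; apply/negP; rewrite -ltNge.
set N := (4 * n.+1)%N in nN *.
have uN : 1 - x N <= 1 - x n by rewrite lerD2l lerN2 x_homo.
have un1 : 1 - x n.+1 <= 1 - x n by rewrite lerD2l lerN2 x_homo.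
(* [f1 - f2] is a multiple of [1 - x], so that [1 - y] is controlled as well. *)
have vN : 1 - y N <= 2 * (1 - x n).
  have := x_le n; have := y_ge n; rewrite -/N.
  have -> : f1 (x n) (y n) = f2 (x n) (y n) + (1 - p1) * p2 * (1 - x n).
    by rewrite /f1 /f2; ring.
  have /andP[_ p1_le1] := p01 1; have /andP[p2_ge0 p2_le1] := p01 2.
  have : (1 - p1) * p2 * (1 - x n) <= 1 * (1 - x n).
    rewrite ler_wpM2r ?(ltW (u_gt0 _)) // -[leRHS](mulr1 1) ler_pM ?subr_ge0 //.
    by rewrite gerBl ltW.
  by move: (_ * (1 - x n)) (f2 _ _) => *; lra.
apply: (@le_lt_trans _ _ (2 * (1 - x n))); last first.
  by move: m_lt un; rewrite -/(x m); move: ((1 - c) / 2 * _) => *; lra.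
have h1 : (1 - c) * (1 - x N) <= (1 - c) * (1 - x n) by rewrite ler_pM2l.
have h2 : c * (1 - y N) <= c * (2 * (1 - x n)) by rewrite ler_pM2l.
have h3 : c * (1 - x n) <= 2^-1 * (1 - x n).
  by rewrite ler_pM2r ?u_gt0 // ltW.
have := u_gt0 n; rewrite /S; move: h1 h2 h3.
rewrite (mulrBl (1 - x n)) mul1r (mulrCA c 2).
move: (1 - x n) => u; move: (c * u) (_ * (1 - x N)) (c * _) => *; lra.
Qed.

End Critical.

(** * Histories *)

Section Histories.
Variables (R : realType) (b : nat) (str : nat -> R).
Hypothesis b_gt0 : (0 < b)%N.
Hypothesis str01 : forall j, 0 <= str j <= 1.
Local Notation vertex := (seq 'I_b).
Local Notation history := (seq vertex).
Local Notation exc := (exc str).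
Local Notation exck := (@exck R b str).
Implicit Types (x y z w : vertex) (h : history) (f g : history -> R).

Definition root_history : history := [:: [::]].

(** Histories are listed backwards in time; [step f h] is the expectation of [f]
    one step after [h]. *)
Definition step f h : R :=
  avg (str (count_mem (head [::] h) h)) (fun i => f ((i :: head [::] h) :: h))
    (f (behead (head [::] h) :: h)).

Definition expect n f : history -> R := iter n step f.

Lemma expect0 f h : expect 0 f h = f h.
Proof. by []. Qed.

Lemma expectS n f h : expect n.+1 f h = step (expect n f) h.
Proof. by []. Qed.

Lemma expectD n m f : expect (n + m) f = expect n (expect m f).
Proof. exact: iterD. Qed.

Lemma step_le f g h : (forall y, f (y :: h) <= g (y :: h)) ->
  step f h <= step g h.
Proof. by move=> fg; apply: avg_le. Qed.

Lemma step_cst c h : step (fun=> c) h = c.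
Proof. exact: avg_const. Qed.

Lemma expect_le n f g h : (forall h', f h' <= g h') ->
  expect n f h <= expect n g h.
Proof. by move=> fg; elim: n h => [//|n IH] h; apply: step_le => y;
  apply: IH. Qed.

Lemma expect_cst n c h : expect n (fun=> c) h = c.
Proof.
elim: n h => [//|n IH] h; rewrite expectS -[RHS](step_cst c h).
by congr step; apply/funext.
Qed.

Lemma expect_ge0 n f h : (forall h', 0 <= f h') -> 0 <= expect n f h.
Proof. by move=> f0; rewrite -(expect_cst n 0 h); apply: expect_le. Qed.

Lemma expect_lin n a c f g h :
  expect n (fun h' => a * f h' + c * g h') h =
  a * expect n f h + c * expect n g h.
Proof.
elim: n h => [//|n IH] h; rewrite !expectS -avg_lin /step IH; congr avg.
by apply/funext => i; rewrite IH.
Qed.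

Lemma expectZ n a f h : expect n (fun h' => a * f h') h = a * expect n f h.
Proof.
have := expect_lin n a 0 f f h; rewrite mul0r addr0 => <-.
by congr expect; apply/funext => h'; rewrite mul0r addr0.
Qed.

Lemma expectD_fun n f g h :
  expect n (fun h' => f h' + g h') h = expect n f h + expect n g h.
Proof.
have := expect_lin n 1 1 f g h; rewrite !mul1r => <-.
by congr expect; apply/funext => h'; rewrite !mul1r.
Qed.

Lemma expect_sum n (I : Type) (r : seq I) (F : I -> history -> R) h :
  expect n (fun h' => \sum_(i <- r) F i h') h = \sum_(i <- r) expect n (F i) h.
Proof.
elim: r => [|i r IH].
  by under eq_fun do rewrite big_nil; rewrite expect_cst big_nil.
by under eq_fun do rewrite big_cons; rewrite expectD_fun IH big_cons.
Qed.

Lemma expect_homo n n' f h : (forall y h', f h' <= f (y :: h')) ->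
  (n <= n')%N -> expect n f h <= expect n' f h.
Proof.
move=> f_homo nn'; rewrite -(subnK nn') addnC expectD; apply: expect_le => h'.
elim: (n' - n)%N h' => [//|k IH] h'; rewrite expectS -[leLHS](step_cst _ h').
by apply: step_le => y; apply: le_trans (IH _).
Qed.

(** Only finitely many histories can follow [h] in [n] steps, hence a common
    [m0]. *)
Lemma expect_uniform n (F : nat -> history -> R) g h :
  (forall h', exists m0, forall m, (m0 <= m)%N -> F m h' <= g h') ->
  exists m0, forall m, (m0 <= m)%N -> expect n (F m) h <= expect n g h.
Proof.
elim: n h => [|n IH] h Fg; first exact: Fg.
have {}IH h' := IH h' Fg.
have [m1 m1P] := IH (behead (head [::] h) :: h).
have [m2 m2P] := choice (fun i : 'I_b => IH ((i :: head [::] h) :: h)).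
exists (maxn m1 (\max_i m2 i)) => m; rewrite geq_max => /andP[m1m m2m].
apply: avg_le => // [i|]; last exact: m1P.
by apply: m2P; apply: leq_trans m2m; apply: leq_bigmax.
Qed.

Lemma son_neq_father x i : (i :: x == behead x) = false.
Proof.
by apply/eqP => /(congr1 size); rewrite size_behead /=; case: (size x); lia.
Qed.

(** The configuration of the subtree below [z] after the departures [h]. *)
Definition conf z h : env b := fun w => count_mem (w ++ z) h.

Lemma conf_bump z w h : conf z ((w ++ z) :: h) = bump (conf z h) w.
Proof.
apply/funext => w'; rewrite /conf /bump /= addnC; congr (_ + nat_of_bool _)%N.
apply/eqP/eqP => [e|->//].
have sz : size w = size w' by move: (congr1 size e);
  rewrite !size_cat => /addIn.
by move/eqP: e; rewrite eqseq_cat // => /andP[/eqP ->].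
Qed.

Lemma conf_count z w h : count_mem (w ++ z) ((w ++ z) :: h) = (conf z h w).+1.
Proof. by rewrite /= eqxx. Qed.

Fixpoint downs i h : nat :=
  if h is y :: h' then
    (downs i h' +
      (if h' is x :: _ then (size x == i) && (y == behead x) else false))%N
  else 0%N.

Definition visits_to_level i h : nat := count (fun x => size x == i) h.

Lemma downs_son i j x h : downs i ((j :: x) :: x :: h) = downs i (x :: h).
Proof. by rewrite [LHS]/= son_neq_father andbF addn0. Qed.

Lemma downs_le_visits i h : (downs i.+1 h <= visits_to_level i h)%N.
Proof.
elim: h => [//|y [|x h] IH]; rewrite [downs _ _]/=; first by [].
rewrite /visits_to_level [count _ _]/= addnC; apply: leq_add => //.
case: eqP => //= sx; case: eqP => //= ->; by rewrite size_behead sx eqxx.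
Qed.

(** The father of the root is the root itself, so the descents from level 0 are
    the ends of the excursions below the root, which start again at once. *)
Lemma expect_root_downs m n k h x : (m <= n)%N ->
  expect m (fun h' => (downs 0 (x :: h) + k.+1 <= downs 0 h')%N%:R) (x :: h) <=
  exc m (exck n k) (conf [::] h) x.
Proof.
elim: m k h x => [|m IH] k h x mn.
  by rewrite /= addnS ltnNge leq_addr.
have {}IH k' h' x' := IH k' h' x' (ltnW mn).
have cB : conf [::] (x :: h) = bump (conf [::] h) x.
  by have := conf_bump [::] x h; rewrite cats0.
have cC : count_mem x (x :: h) = (conf [::] h x).+1.
  by have := conf_count [::] x h; rewrite cats0.
rewrite expectS /step [head _ _]/= cC; apply: avg_le => // [i|].
  by rewrite -(downs_son 0 i x h) -cB; apply: IH.
rewrite -cB; case: x => [|j x] in IH cB cC *; last first.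
  rewrite (_ : downs 0 _ = downs 0 (behead (j :: x) :: (j :: x) :: h)).
    exact: IH.
  by rewrite [RHS]/= addn0.
have dS : (downs 0 ([::] :: h)).+1 = downs 0 ([::] :: [::] :: h).
  by rewrite [RHS]/= addn1.
case: k => [|k].
  rewrite -[leRHS](expect_cst m _ (behead [::] :: [::] :: h)).
  by apply: expect_le => h'; rewrite lern1 leq_b1.
rewrite addnS -addSn dS; apply: (le_trans (IH _ _ _)).
apply: exc_leW; first exact: str01.
  exact: ltnW.
by move=> e'; apply: exck_ge0.
Qed.

Definition tight (G : history -> nat) := forall eps : R, 0 < eps ->
  exists k, forall n, expect n (fun h => (k <= G h)%N%:R) root_history <= eps.

Lemma tight_le G G' : (forall h, (G h <= G' h)%N) -> tight G' -> tight G.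
Proof.
move=> GG' tG' eps /tG'[k kP]; exists k => n; apply: le_trans (kP n).
apply: expect_le => h; apply: ler_indic => /leq_trans; exact.
Qed.

Lemma tight_downs0 :
  (forall r, exists k, forall n, exck n k fresh <= r.+2%:R^-1) ->
  tight (downs 0).
Proof.
move=> vanish eps eps0.
have [k kP] := vanish (Num.trunc eps^-1); exists k => n.
apply: (@le_trans _ _ (exck n k fresh)).
  case: k kP => [|k] _.
    rewrite -[leRHS](expect_cst n _ root_history); apply: expect_le => h.
    by rewrite lern1 leq_b1.
  have := @expect_root_downs n n k [::] [::] (leqnn n).
  rewrite (_ : downs 0 [:: [::]] = 0%N) // => /le_trans; apply.
apply: (le_trans (kP n)); rewrite invf_ple ?posrE ?ltr0n //.
rewrite ltW // (lt_le_trans (truncnS_gt _)) // ler_nat //.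
Qed.

(** From a vertex the walk jumps to the father with probability at least
    [1 - alpha], so that the expectation of
    [2 ^- downs * (2 / (1 + alpha)) ^ visits] does not grow: many visits to a
    level with few descents from it are unlikely. *)
Lemma tight_visits i alpha : 0 <= alpha < 1 -> (forall j, str j <= alpha) ->
  tight (downs i) -> tight (visits_to_level i).
Proof.
move=> /andP[alpha0 alpha1] str_le tD eps eps0.
pose lam : R := 2 / (1 + alpha).
have lam_gt0 : 0 < lam by rewrite divr_gt0 // ltr_wpDr.
pose U h : R := 2^-1 ^+ downs i h * lam ^+ visits_to_level i (behead h).
have U0 h : 0 <= U h by rewrite mulr_ge0 ?exprn_ge0 ?invr_ge0 // ltW.
have U_step x h : step U (x :: h) <= U (x :: h).
  rewrite /step [head _ _]/=; set p := str _.
  have p01 : 0 <= p <= 1 := str01 _.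
  have [sx|sx] := eqVneq (size x) i; last first.
    rewrite -[leRHS](avg_const p _ b_gt0); apply: avg_le => // [j|].
      by rewrite /U downs_son /visits_to_level /= (negbTE sx).
    by rewrite /U /visits_to_level /= (negbTE sx) addn0.
  have eS j : U ((j :: x) :: x :: h) = lam * U (x :: h).
    by rewrite /U downs_son /visits_to_level /= sx eqxx add1n exprS; ring.
  have eF : U (behead x :: x :: h) = lam / 2 * U (x :: h).
    rewrite /U /visits_to_level /= sx eqxx add1n eqxx addn1 !exprS; ring.
  rewrite (_ : (fun j => _) = (fun=> lam * U (x :: h))); last exact/funext.
  rewrite eF (_ : avg _ _ _ = lam * (1 + p) / 2 * U (x :: h)); last first.
    have := @avg_const _ b p (lam * U (x :: h)) b_gt0; rewrite /avg => e.
    rewrite -[p / _ * _](addrK ((1 - p) * (lam * U (x :: h)))) e.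
    by move: (U _) => u; field.
  have alpha1_gt0 : 0 < 1 + alpha by rewrite ltr_wpDr.
  rewrite -[leRHS]mul1r ler_wpM2r // (_ : _ / 2 = (1 + p) / (1 + alpha)).
    by rewrite ler_pdivrMr // mul1r lerD2l; apply: str_le.
  by rewrite /lam; field; rewrite lt0r_neq0.
have expect_U n : expect n U root_history <= 1.
  have : forall x h, expect n U (x :: h) <= U (x :: h).
    elim: n => [//|n IH] x h; rewrite expectS; apply: le_trans (U_step x h).
    by apply: step_le.
  by move=> /(_ [::] [::]); rewrite /U /= mul1r.
have [k kP] := tD _ (divr_gt0 eps0 (ltr0Sn R 1)).
have lam1 : 0 <= lam^-1 < 1.
  rewrite invr_ge0 (ltW lam_gt0) invf_lt1 // ltr_pdivlMr ?mul1r; lra.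
have [r rP] := geometric_small (2 ^+ k) lam1 (divr_gt0 eps0 (ltr0Sn R 1)).
exists r.+1 => n.
apply: (@le_trans _ _ (expect n (fun h => (k <= downs i h)%N%:R +
    (2 ^+ k * lam^-1 ^+ r) * U h) root_history)).
  apply: expect_le => h; have [kd|dk] := leqP k (downs i h).
    rewrite -[leLHS]addr0 lerD ?mulr_ge0 ?exprn_ge0 ?invr_ge0 ?(ltW lam_gt0) //.
    by rewrite lern1 leq_b1.
  rewrite add0r; case: ltnP => rv; last first.
    by rewrite mulr_ge0 ?U0 ?mulr_ge0 ?exprn_ge0 ?invr_ge0 ?(ltW lam_gt0).
  have {rv} rv : (r <= visits_to_level i (behead h))%N.
    move: rv; rewrite /visits_to_level; case: h {dk} => [//|x h] /=.
    by case: eqP; rewrite ?add1n ?add0n // => _ /ltnW.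
  rewrite /U mulrACA -[leLHS](mulr1 1); apply: ler_pM => //.
    rewrite exprVn ler_pdivlMr ?exprn_gt0 // mul1r.
    by rewrite ler_eXn2l ?ltr1n // ltnW.
  rewrite exprVn mulrC ler_pdivlMr ?exprn_gt0 // mul1r ler_eXn2l //.
  by rewrite ltr_pdivlMr ?mul1r; lra.
rewrite expectD_fun.
have -> : expect n (fun h => 2 ^+ k * lam^-1 ^+ r * U h) root_history =
    2 ^+ k * lam^-1 ^+ r * expect n U root_history.
  exact: expectZ.
rewrite [eps]splitr lerD //.
apply: (@le_trans _ _ (2 ^+ k * lam^-1 ^+ r)); last exact/ltW/rP.
by rewrite ler_piMr ?mulr_ge0 ?exprn_ge0 ?invr_ge0 // ltW.
Qed.

(** A descent from a level is a visit to the previous one. *)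
Lemma tight_levels alpha i : 0 <= alpha < 1 -> (forall j, str j <= alpha) ->
  tight (downs 0) -> tight (visits_to_level i).
Proof.
move=> alpha01 str_le tD; elim: i => [|i IH];
  apply: (tight_visits alpha01 str_le) => //.
by apply: tight_le IH; apply: downs_le_visits.
Qed.

End Histories.

(** * Long excursions *)

Section Runs.
Variables (R : realType) (b : nat) (str : nat -> R).
Hypothesis b_gt0 : (0 < b)%N.
Hypothesis str01 : forall j, 0 <= str j <= 1.
Local Notation vertex := (seq 'I_b).
Local Notation history := (seq vertex).
Local Notation exc := (exc str).
Local Notation exck := (@exck R b str).
Local Notation step := (step str).
Local Notation expect := (expect str).
Implicit Types (x y z w : vertex) (h : history) (f g : history -> R).

Definition below i h := all (fun x => size x < i)%N h.

(** The time elapsed since the level [i] was reached for the first time, as long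
    as the walk has not come back to the level [i.-1]: this is the age of the
    excursion above the first vertex visited at level [i]. *)
Fixpoint run i h : option nat :=
  if h is y :: h' then
    if run i h' is Some t then if (i <= size y)%N then Some t.+1 else None
    else if below i h' && (i <= size y)%N then Some 0%N else None
  else None.

(** The excursion above the first vertex visited at level [i] is known to last
    more than [s] steps. *)
Fixpoint long i s h : bool :=
  if h is y :: h' then (run i h == Some s) || long i s h' else false.

Lemma long_cons i s y h : long i s h -> long i s (y :: h).
Proof. by rewrite /= => ->; rewrite orbT. Qed.

Lemma run_below i h : below i h -> run i h = None.
Proof.
elim: h => [//|y h IH] /= /andP[yi hi].
by rewrite IH // hi /= leqNgt yi.
Qed.

Lemma long_below i s h : below i h -> long i s h = false.
Proof.
elim: h => [//|y h IH] hi; rewrite [LHS]/= -/(run i (y :: h)) (run_below hi).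
by rewrite IH //; case/andP: hi.
Qed.

Lemma run_Some_long i s h : run i h = Some s -> long i s h.
Proof.
by case: h => [//|y h] e; rewrite [long _ _ _]/= -/(run i (y :: h)) e eqxx.
Qed.

Lemma longW i s s' h : (s <= s')%N -> long i s' h -> long i s h.
Proof.
have long_pred t h' : long i t.+1 h' -> long i t h'.
  elim: h' => [//|y h' IH]; rewrite [long _ t.+1 _]/= -/(run i (y :: h')).
  case/orP => [|/IH]; last exact: long_cons.
  rewrite [run _ _]/=; case e: (run i h') => [t'|]; last by case: ifP.
  case: ifP => // _ /eqP[<-]; apply: long_cons; exact: run_Some_long.
move=> /subnK <-; elim: (s' - s)%N => [//|d IH].
by rewrite addSn => /long_pred.
Qed.

(** The excursion is over, and it has been short: nothing changes any more. *)
Lemma expect_over n i s f h : run i h = None -> ~~ below i h ->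
  ~~ long i s h -> expect n (fun h' => (long i s h')%:R * f h') h = 0.
Proof.
elim: n h => [|n IH] h hrun hbelow hlong.
  by rewrite expect0 (negbTE hlong) mul0r.
have IH' y : expect n (fun h' => (long i s h')%:R * f h') (y :: h) = 0.
  have run0 : run i (y :: h) = None by rewrite /= hrun (negbTE hbelow).
  apply: IH => //; first by rewrite /= (negbTE hbelow) andbF.
  by rewrite [long _ _ _]/= -/(run i (y :: h)) run0 (negbTE hlong).
rewrite expectS -[RHS](step_cst str b_gt0 0 h) /step IH'; congr avg.
by apply/funext => j; apply: IH'.
Qed.

Lemma avg_compl p (u : 'I_b -> R) v beta :
  avg p (fun i => (1 - u i) * beta) ((1 - v) * beta) = (1 - avg p u v) * beta.
Proof.
have := avg_lin p beta (- beta) (fun=> 1) u 1 v; rewrite avg_const // => e.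
rewrite [RHS](_ : _ = beta * 1 + - beta * avg p u v); last by ring.
rewrite -e; congr avg; last by ring.
by apply/funext => i; ring.
Qed.

Lemma run_son i j x h r : run i (x :: h) = Some r ->
  run i ((j :: x) :: x :: h) = Some r.+1.
Proof.
move=> rx; rewrite [LHS]/= -/(run i (x :: h)) rx ifT //.
apply: leqW; move: rx => /=; case: (run i h) => [t|]; case: ifP => //.
by case/andP.
Qed.

(** In this section [f] indicates an event whose probability is at most [beta]
    when the excursion above the level [i] reaches the age [s]: either the sure
    event, or a long excursion above a level that has not been reached yet. *)
Section Bound.
Variables (i s : nat) (f : history -> R) (beta : R).
Hypothesis i_gt0 : (0 < i)%N.
Hypothesis f_ge0 : forall h, 0 <= f h.
Hypothesis beta_ge0 : 0 <= beta.
Hypothesis f_le : forall h n, run i h = Some s -> below (i + s).+1 h ->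
  expect n f h <= beta.

Lemma expect_running n r w z h : size z = i ->
  run i ((w ++ z) :: h) = Some r -> (r <= s)%N ->
  ((r < s)%N -> ~~ long i s ((w ++ z) :: h)) ->
  below (i + r).+1 ((w ++ z) :: h) ->
  expect n (fun h' => (long i s h')%:R * f h') ((w ++ z) :: h) <=
  (1 - exc (s - r) (fun=> 1) (conf z h) w) * beta.
Proof.
have exc_le c w' e : exc c (fun=> 1) e w' <= 1 by apply: exc_le1.
move=> sz.
have at_s k w' h' : run i ((w' ++ z) :: h') = Some s ->
    below (i + s).+1 ((w' ++ z) :: h') ->
    expect k (fun h' => (long i s h')%:R * f h') ((w' ++ z) :: h') <=
    (1 - exc (s - s) (fun=> 1) (conf z h') w') * beta.
  move=> hr hb; rewrite subnn [exc _ _ _ _]/= subr0 mul1r.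
  apply: le_trans (f_le k hr hb).
  apply: expect_le => // h''; rewrite -[leRHS]mul1r ler_wpM2r //.
  by rewrite lern1 leq_b1.
elim: n r w h => [|n IH] r w h hr rs nlong hb.
  have [/eqP rsE|rs'] := boolP (r == s); first by rewrite rsE in hr hb *;
    apply: at_s.
  have {}nlong : ~~ long i s ((w ++ z) :: h) by apply: nlong;
    rewrite ltn_neqAle rs'.
  by rewrite expect0 (negbTE nlong) mul0r mulr_ge0 // subr_ge0.
have [/eqP rsE|rs'] := boolP (r == s); first by rewrite rsE in hr hb *;
  apply: at_s.
have {rs'} rs' : (r < s)%N by rewrite ltn_neqAle rs'.
have {}nlong : ~~ long i s ((w ++ z) :: h) by apply: nlong.
have below_cons y : (size y <= (size (w ++ z)).+1)%N ->
    below (i + r.+1).+1 (y :: (w ++ z) :: h).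
  move=> sy; rewrite /below [all _ _]/=; case/andP: hb => hx hb.
  rewrite !ltnS addnS; rewrite ltnS in hx; apply/and3P; split.
  - by rewrite (leq_trans sy).
  - exact: leqW.
  - by apply: sub_all hb => v; rewrite !ltnS => /leqW.
have nlong_cons y : run i (y :: (w ++ z) :: h) = Some r.+1 -> (r.+1 < s)%N ->
    ~~ long i s (y :: (w ++ z) :: h).
  move=> ry rs1; rewrite [long _ _ _]/= -/(run i (y :: (w ++ z) :: h)) ry.
  rewrite -/(long i s ((w ++ z) :: h)) (negbTE nlong) orbF.
  by apply/eqP => -[e]; rewrite e ltnn in rs1.
rewrite expectS /step [head _ _]/= conf_count.
rewrite -(subnSK rs') [exc _ _ _ _]/= -avg_compl -conf_bump.
apply: avg_le => // [j|].
  have rj := run_son j hr.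
  by apply: (IH r.+1 (j :: w)) => //; [exact: nlong_cons | exact: below_cons].
case: w => [|j w] in hr nlong hb below_cons nlong_cons *; last first.
  have rj : run i ((w ++ z) :: ((j :: w) ++ z) :: h) = Some r.+1.
    by rewrite [LHS]/= -/(run i ((j :: w ++ z) :: h)) hr size_cat sz leq_addl.
  apply: IH => //; first exact: nlong_cons.
  by apply: below_cons; rewrite leqW.
rewrite subrr mul0r cat0s in hr nlong hb *.
have szb : (i <= size (behead z))%N = false.
  by rewrite size_behead sz; case: (i) i_gt0 => // k _; rewrite ltnn.
have run0 : run i (behead z :: z :: h) = None.
  by rewrite [LHS]/= -/(run i (z :: h)) hr szb.
rewrite expect_over //.
  by rewrite /below /= sz ltnn /= andbF.
rewrite [long _ _ _]/= -/(run i (behead z :: z :: h)) run0.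
by rewrite -/(long i s (z :: h)) (negbTE nlong).
Qed.

Lemma conf_below z h : (forall x, x \in h -> (size x < size z)%N) ->
  conf z h = fresh.
Proof.
move=> hz; apply/funext => w; apply/count_memPn/negP => /hz.
by rewrite size_cat ltnNge leq_addl.
Qed.

(** A vertex reached for the first time has an unvisited subtree below it, so
    the excursion above it lasts more than [s] steps with the same probability
    as from the fresh configuration, whatever has happened before. *)
Lemma expect_long_le n h : below i h ->
  expect n (fun h' => (long i s h')%:R * f h') h <=
  (1 - exck s 1 fresh) * beta.
Proof.
elim: n h => [|n IH] h hb.
  rewrite expect0 long_below // mul0r mulr_ge0 // subr_ge0.
  exact: exck_le1.
have hx : (size (head [::] h) < i)%N by case: h hb => [|x h] // /andP[].
have le_y y : (size y <= i)%N -> expect n (fun h' => (long i s h')%:R * f h')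
    (y :: h) <= (1 - exck s 1 fresh) * beta.
  rewrite leq_eqVlt => /predU1P[sy|sy]; last first.
    by apply: IH; rewrite /below /= sy.
  have ry : run i (y :: h) = Some 0%N.
    by rewrite [LHS]/= -/(below i h) (run_below hb) hb sy leqnn.
  have := @expect_running n 0 [::] y h sy ry (leq0n s).
  rewrite subn0 conf_below; last first.
    by move=> x xh; rewrite sy; apply: (allP hb).
  apply.
    rewrite [long _ _ _]/= -/(run i (y :: h)) ry -/(long i s h) long_below //.
    by rewrite orbF; case: (s).
  rewrite addn0 /below [all _ _]/= ltnS sy leqnn.
  by apply: sub_all hb => x; apply: leqW.
rewrite expectS /step -[leRHS](avg_const (str (count_mem (head [::] h) h)) _
    b_gt0).
apply: avg_le => // [j|]; apply: le_y => //.
by rewrite size_behead (leq_trans (leq_pred _)) // ltnW.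
Qed.

End Bound.

Local Notation tail s := (1 - exck s 1 fresh).

Lemma expect_long1 i s n h : (0 < i)%N -> below i h ->
  expect n (fun h' => (long i s h')%:R) h <= tail s.
Proof.
move=> i0 hb; rewrite -[leRHS]mulr1.
have <- : expect n (fun h' => (long i s h')%:R * 1) h =
    expect n (fun h' => (long i s h')%:R) h.
  by congr expect; apply/funext => h'; rewrite mulr1.
by apply: expect_long_le => // h' n' _ _; rewrite expect_cst.
Qed.

Lemma expect_long2 i j s t n h : (0 < i)%N -> (i + s < j)%N -> below i h ->
  expect n (fun h' => (long i s h')%:R * (long j t h')%:R) h <=
  tail s * tail t.
Proof.
move=> i0 sj hb; apply: expect_long_le => // [|h' n' _ hb'].
  by rewrite subr_ge0 exck_le1.
apply: expect_long1; first by apply: leq_trans sj.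
by apply: sub_all hb' => x; rewrite !ltnS => /leq_ltn_trans; apply.
Qed.

Lemma expect_long_running i s n r w z h : size z = i ->
  run i ((w ++ z) :: h) = Some r -> (r <= s)%N -> (s <= r + n)%N ->
  1 - exc (s - r) (fun=> 1) (conf z h) w <=
  expect n (fun h' => (long i s h')%:R) ((w ++ z) :: h).
Proof.
move=> sz.
elim: n r w h => [|n IH] r w h hr; rewrite leq_eqVlt => /predU1P[rs|rs].
- by rewrite expect0 rs run_Some_long -?rs // gerBl ?exc_ge0.
- by rewrite addn0 leqNgt rs.
- move=> _; have h1 : long i s ((w ++ z) :: h) by rewrite run_Some_long // -rs.
  apply: le_trans (_ : 1 <= _); first by rewrite gerBl exc_ge0.
  rewrite -[leLHS]/(true%:R) -h1.
  apply: (@expect_homo _ _ str b_gt0 str01 0 n.+1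
    (fun h' => (long i s h')%:R)) => // y h'.
  by apply: ler_indic; apply: long_cons.
move=> sn; rewrite expectS /step [head _ _]/= conf_count -(subnSK rs).
have := @avg_compl (str (conf z h w).+1)
  (fun j => exc (s - r.+1) (fun=> 1) (conf z ((w ++ z) :: h)) (j :: w))
  (if w is _ :: w' then exc (s - r.+1) (fun=> 1) (conf z ((w ++ z) :: h)) w'
   else 1) 1.
rewrite !mulr1 [exc _.+1 _ _ _]/= -conf_bump => <-; apply: avg_le => // [j|].
  by rewrite mulr1; apply: (IH r.+1 (j :: w)) => //;
    [exact: run_son|rewrite addSnnS].
case: w => [|j w] in hr *; first by rewrite subrr expect_ge0.
have rj : run i ((w ++ z) :: ((j :: w) ++ z) :: h) = Some r.+1.
  by rewrite [LHS]/= -/(run i ((j :: w ++ z) :: h)) hr size_cat sz leq_addl.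
by apply: IH => //; rewrite addSnnS.
Qed.

Lemma expect_long_ge i s n h : (0 < i)%N -> below i h ->
  tail s * expect n (fun h' => (~~ below i h')%:R) h <=
  expect (n + s) (fun h' => (long i s h')%:R) h.
Proof.
have t0 : 0 <= tail s by rewrite subr_ge0 exck_le1.
move=> i0; elim: n h => [|n IH] h hb.
  by rewrite expect0 hb mulr0 expect_ge0.
have hx : (size (head [::] h) < i)%N by case: h hb => [|x h] // /andP[].
have le_y y : (size y <= i)%N ->
    tail s * expect n (fun h' => (~~ below i h')%:R) (y :: h) <=
    expect (n + s) (fun h' => (long i s h')%:R) (y :: h).
  rewrite leq_eqVlt => /predU1P[sy|sy]; last first.
    by apply: IH; rewrite /below /= sy.
  have ry : run i (y :: h) = Some 0%N.
    by rewrite [LHS]/= -/(below i h) (run_below hb) hb sy leqnn.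
  apply: (@le_trans _ _ (tail s)).
    rewrite -[leRHS]mulr1 ler_wpM2l // -[leRHS](expect_cst str b_gt0 n _ (y ::
        h)).
    by apply: expect_le => // h'; rewrite lern1 leq_b1.
  have := @expect_long_running i s (n + s) 0 [::] y h sy ry (leq0n s).
  rewrite subn0 conf_below; last first.
    by move=> x xh; rewrite sy; apply: (allP hb).
  by apply; rewrite add0n leq_addl.
rewrite addSn !expectS /step.
rewrite -avg_scale; apply: avg_le => // [j|].
  exact: le_y.
by apply: le_y; rewrite size_behead (leq_trans (leq_pred _)) // ltnW.
Qed.

End Runs.

(** * Infinitely many long excursions *)

Section SecondMoment.
Variables (R : realType) (b : nat) (str : nat -> R).
Hypothesis b_gt0 : (0 < b)%N.
Hypothesis str01 : forall j, 0 <= str j <= 1.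
Local Notation vertex := (seq 'I_b).
Local Notation history := (seq vertex).
Local Notation expect := (expect str).
Local Notation tail s := (1 - @exck R b str s 1 fresh).
Implicit Types (h : history).

Hypothesis tail_divergence : forall A, exists n, A <= \sum_(i < n) tail i.

Let tail_ge0 s : 0 <= tail s. Proof. by rewrite subr_ge0 exck_le1. Qed.

Let tail_le1 s : tail s <= 1. Proof. by rewrite gerBl exck_ge0. Qed.

Let tail_anti s t : (s <= t)%N -> tail t <= tail s.
Proof. by move=> st; rewrite lerD2l lerN2; apply: exck_leW. Qed.

Let sum_tail_blocks K n :
  \sum_(d < K * n) tail d <= K%:R * \sum_(i < n) tail (K * i).
Proof.
elim: n => [|n IH]; first by rewrite muln0 !big_ord0 mulr0.
rewrite mulnS addnC big_split_ord big_ord_recr /= mulrDr; apply: lerD => //.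
rewrite -[X in X%:R]card_ord mulr_natl -sumr_const; apply: ler_sum => i _.
by apply: tail_anti; apply: leq_addr.
Qed.

Let sum_tail_rev n j : (j <= n)%N ->
  \sum_(i < n | (i < j)%N) tail (j - i.+1) <= \sum_(d < n) tail d.
Proof.
move=> jn; rewrite -(big_ord_widen n (fun i => tail (j - i.+1)) jn).
rewrite (reindex_inj rev_ord_inj) /=.
rewrite (_ : \sum_(i < j) _ = \sum_(i < j) tail i); last first.
  by apply: eq_bigr => i _; rewrite subnSK // subKn // ltnW.
rewrite (big_ord_widen n (fun i => tail i) jn) [leRHS](bigID (fun i : 'I_n =>
    i < j)%N) /=.
by rewrite lerDl; apply: sumr_ge0 => i _; apply: tail_ge0.
Qed.

(** The tail is nonincreasing, so its sum over an interval is at most [K] times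
    its sum over the multiples of [K], up to the first [K * m] terms. *)
Lemma sum_tail_window K m L : (0 < K)%N ->
  \sum_(d < L) tail d <=
  K%:R * m%:R + K%:R * \sum_(k < L) tail (K * (m + k)).
Proof.
move=> K_gt0; apply: (@le_trans _ _ (\sum_(d < K * (m + L)) tail d)).
  have LK : (L <= K * (m + L))%N.
    by apply: leq_trans (leq_addl m L) _; rewrite leq_pmull.
  rewrite (big_ord_widen _ (fun d => tail d) LK).
  rewrite [leRHS](bigID (fun i : 'I_(_) => i < L)%N) /= lerDl.
  by apply: sumr_ge0 => i _; apply: tail_ge0.
apply: (le_trans (sum_tail_blocks _ _)).
rewrite big_split_ord /= -mulrDr ler_wpM2l // lerD2r.
rewrite -[X in X%:R]card_ord -sumr_const.
by apply: ler_sum => i _; apply: tail_le1.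
Qed.

Lemma window_divergence K m A : (0 < K)%N ->
  exists L, A <= \sum_(k < L) tail (K * (m + k)).
Proof.
move=> K_gt0; have [n nP] := tail_divergence (K%:R * (m%:R + A)).
exists n; have := le_trans nP (sum_tail_window m n K_gt0).
by rewrite -mulrDr ler_pM2l ?ltr0n // lerD2l.
Qed.

Section Window.
(** The levels [m], ..., [m + L - 1]; the excursion at level [i] should last
    more than [K * i] steps. *)
Variables (K m L : nat).
Hypothesis K_gt0 : (0 < K)%N.
Hypothesis m_gt0 : (0 < m)%N.

Let T (k : nat) : R := tail (K * (m + k)).
Let I (k : 'I_L) h : R := (long (m + k) (K * (m + k)) h)%:R.
Let Z h : R := \sum_(k < L) I k h.
Let S : R := \sum_(k < L) T k.
Let W : R := \sum_(d < L) tail d.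

Let T_ge0 k : 0 <= T k. Proof. exact: tail_ge0. Qed.

Let W_le : W <= K%:R * m%:R + K%:R * S.
Proof. exact: sum_tail_window. Qed.

(** When the walk reaches the level [m + l], the excursion above the level [m
    + k] is either over, and its duration is known, or still running, and it
    has already lasted at least [l - k] steps. In both cases this knowledge is
    independent of the excursion above the level [m + l]. *)
Let pair_le n h (k l : 'I_L) : below m h -> (k < l)%N ->
  expect n (fun h' => I k h' * I l h') h <= T k * T l + T l * tail (l - k.+1).
Proof.
move=> hb kl; have hbk : below (m + k) h.
  by apply: sub_all hb => x /leq_trans; apply; apply: leq_addr.
have mk0 : (0 < m + k)%N by rewrite addn_gt0 m_gt0.
pose s := minn (K * (m + k)) (l - k.+1).
have sl : (m + k + s < m + l)%N.
  rewrite -addnA ltn_add2l (leq_ltn_trans (leq_add (leqnn k) (geq_minr _ _)))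
      //.
  by rewrite -addnS subnSK // subnKC // ltnW.
apply: (@le_trans _ _ (tail s * T l)).
  apply: le_trans (expect_long2 b_gt0 str01 (K * (m + l)) n mk0 sl hbk).
  apply: expect_le => // h'; rewrite /I ler_wpM2r // ler_indic //.
  exact: longW (geq_minl _ _).
rewrite [T l * _]mulrC -mulrDl; apply: ler_wpM2r; first exact: T_ge0.
rewrite /s /minn; case: ifP => _; first by rewrite lerDl tail_ge0.
by rewrite lerDr tail_ge0.
Qed.

Let second_moment_le n h : below m h ->
  expect n (fun h' => Z h' ^+ 2) h <= S + S ^+ 2 + 2 * (S * W).
Proof.
move=> hb.
have -> : expect n (fun h' => Z h' ^+ 2) h =
    \sum_(k < L) \sum_(l < L) expect n (fun h' => I k h' * I l h') h.
  rewrite (_ : (fun h' => Z h' ^+ 2) =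
    (fun h' => \sum_(k < L) \sum_(l < L) I k h' * I l h')); last first.
    by apply/funext => h'; rewrite expr2 /Z big_distrlr.
  by rewrite (expect_sum str b_gt0); apply: eq_bigr => k _;
    rewrite (expect_sum str b_gt0).
pose D (k l : 'I_L) := if k == l then T k else 0.
pose C (k l : 'I_L) := if (k < l)%N then T l * tail (l - k.+1) else 0.
have bound (k l : 'I_L) : expect n (fun h' => I k h' * I l h') h <=
    D k l + T k * T l + (C k l + C l k).
  rewrite /D /C; have [->|kl] := eqVneq k l.
    rewrite ltnn !addr0; apply: ler_wpDr; first by rewrite mulr_ge0 ?T_ge0.
    apply: le_trans (expect_long1 b_gt0 str01 (i := m + l) _ n _ _).
    - apply: expect_le => // h'; rewrite /I.
      by case: long; rewrite ?mulr1 ?mulr0.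
    - by rewrite addn_gt0 m_gt0.
    - by apply: sub_all hb => x /leq_trans; apply; apply: leq_addr.
  rewrite add0r; have [lt_kl|lt_lk|e] := ltngtP k l.
  - by rewrite addr0; apply: pair_le.
  - rewrite add0r mulrC.
    rewrite (_ : (fun h' => _) = (fun h' => I l h' * I k h')); last first.
      by apply/funext => h'; rewrite mulrC.
    exact: pair_le.
  - by move/eqP: kl; case; apply: val_inj.
have sumC : \sum_(k < L) \sum_(l < L) C k l <= S * W.
  rewrite exchange_big /= /S mulr_suml; apply: ler_sum => l _.
  rewrite -big_mkcond /= -mulr_sumr; apply: ler_wpM2l; first exact: T_ge0.
  by apply: sum_tail_rev; apply: ltnW.
apply: (@le_trans _ _ (\sum_(k < L) \sum_(l < L)
    (D k l + T k * T l + (C k l + C l k)))).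
  by apply: ler_sum => k _; apply: ler_sum => l _; apply: bound.
rewrite (eq_bigr (fun k => \sum_(l < L) D k l + \sum_(l < L) T k * T l +
    (\sum_(l < L) C k l + \sum_(l < L) C l k))); last first.
  by move=> k _; rewrite !big_split.
rewrite !big_split /=; apply: lerD; first apply: lerD.
- apply: ler_sum => k _; rewrite (bigD1 k) //= {1}/D eqxx big1 ?addr0 // => l.
  by rewrite /D eq_sym => /negbTE ->.
- by rewrite expr2 /S big_distrlr.
- by rewrite [X in _ + X <= _]exchange_big /= mulr2n mulrDl mul1r lerD.
Qed.

(** Then the second moment of [Z] is at most a multiple of [S ^+ 2]. *)
Hypothesis S_large : 1 + 2 * K%:R * m%:R <= S.

(** Second moment method: the mean of [Z] is at least [S / 2] as soon as the
    walk reaches the level [m + L] with probability [1 / 2], and [Z = Z * J]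
    for the indicator [J] of [Z > 0], so that [(E Z) ^+ 2 <= E (Z ^+ 2) * E
    J]. *)
Lemma long_excursion_prob h : below m h ->
  (exists n, 2^-1 <= expect n (fun h' => (~~ below (m + L) h')%:R) h) ->
  exists n, (8 * K.+1%:R)^-1 <= expect n (fun h' =>
    [exists k : 'I_L, long (m + k) (K * (m + k)) h']%:R) h.
Proof.
move=> hb [n hit]; exists (n + K * (m + L))%N; set n' := (_ + _)%N.
pose J h' : R := [exists k : 'I_L, long (m + k) (K * (m + k)) h']%:R.
rewrite -[X in _ <= X]/(expect n' J h).
have first_moment : S / 2 <= expect n' Z h.
  rewrite /Z (expect_sum str b_gt0) /S mulr_suml; apply: ler_sum => k _.
  have hbk : below (m + k) h.
    by apply: sub_all hb => x /leq_trans; apply; apply: leq_addr.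
  have mk0 : (0 < m + k)%N by rewrite addn_gt0 m_gt0.
  apply: le_trans (_ : expect (n + K * (m + k)) (I k) h <= _); last first.
    apply: expect_homo => // [y h'|].
      by apply: ler_indic; apply: long_cons.
    by rewrite leq_add2l leq_mul2l leq_add2l ltnW ?orbT.
  apply: le_trans (expect_long_ge b_gt0 str01 _ _ mk0 hbk).
  rewrite ler_wpM2l // (le_trans hit) //; apply: expect_le => // h'.
  apply: ler_indic; apply: contra; apply: sub_all => x /leq_trans.
  by apply; rewrite leq_add2l ltnW.
have S_gt0 : 0 < S by apply: lt_le_trans S_large; rewrite ltr_wpDr ?mulr_ge0.
have second_moment : expect n' (fun h' => Z h' ^+ 2) h <=
    2 * K.+1%:R * S ^+ 2.
  apply: (le_trans (second_moment_le _ hb)).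
  have h1 := ler_wpM2l (ltW S_gt0) W_le.
  have h2 := ler_wpM2l (ltW S_gt0) S_large.
  move: h1 h2; rewrite -(natr1 K); move: (K%:R) (m%:R) S W.
  by move=> u v s w h1 h2; lra.
(* The mean of [(Z - t * J) ^+ 2] is nonnegative; this [t] yields the inequality
   of Cauchy and Schwarz up to a factor. *)
have [t tE] : exists t, t = 4 * K.+1%:R * S by eexists.
have quad : 0 <= expect n' (fun h' => (Z h' + - t * J h') ^+ 2) h.
  by apply: expect_ge0 => // h'; apply: sqr_ge0.
move: quad.
have -> : expect n' (fun h' => (Z h' + - t * J h') ^+ 2) h =
    expect n' (fun h' => Z h' ^+ 2) h + (t ^+ 2 * expect n' J h -
      2 * t * expect n' Z h).
  rewrite -(mulNr (2 * t)) -!expectZ -!expectD_fun; congr expect.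
  apply/funext => h'; have J2 : J h' ^+ 2 = J h'.
    by rewrite /J; case: [exists _, _]; rewrite ?expr1n ?expr0n.
  have ZJ : Z h' * J h' = Z h'.
    rewrite /J; case: existsP => [_|noJ]; rewrite ?mulr1 // mulr0.
    rewrite /Z big1 // => k _; rewrite /I; case e: (long _ _ h') => //.
    by case: noJ; exists k.
  by rewrite -[X in _ + (_ * X + _)]J2 -[X in _ + (_ + _ * X)]ZJ; ring.
move=> quad.
have t0 : 0 < t by rewrite tE !mulr_gt0 // ltr0n.
have Kt : 0 < 8 * K.+1%:R :> R by rewrite mulr_gt0 // ltr0n.
have {quad} quad : t ^+ 2 * (8 * K.+1%:R)^-1 <= t ^+ 2 * expect n' J h.
  have : 2 * t * (S / 2) <= 2 * t * expect n' Z h.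
    by rewrite ler_pM2l // mulr_gt0.
  have -> : t ^+ 2 * (8 * K.+1%:R)^-1 = 2 * K.+1%:R * S ^+ 2.
    by rewrite tE; field; rewrite lt0r_neq0 // ltr_wpDr.
  rewrite (_ : 2 * t * (S / 2) = 4 * K.+1%:R * S ^+ 2); last first.
    by rewrite tE; field.
  move: quad second_moment; move: (t ^+ 2 * _) (2 * t * _) => u v.
  by move: (expect _ _ _) => w; rewrite -!mulrA; move: (K.+1%:R * _) => *; lra.
by rewrite -(ler_pM2l (exprn_gt0 2 t0)).
Qed.

End Window.
End SecondMoment.

Section NeverLong.
Variables (R : realType) (b : nat) (str : nat -> R).
Hypothesis b_gt0 : (0 < b)%N.
Hypothesis str01 : forall j, 0 <= str j <= 1.
Local Notation vertex := (seq 'I_b).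
Local Notation history := (seq vertex).
Local Notation expect := (expect str).
Local Notation tail s := (1 - @exck R b str s 1 fresh).
Local Notation root := (root_history b).
Implicit Types (h : history).


Lemma below_leq i j h : (i <= j)%N -> below i h -> below j h.
Proof. by move=> ij; apply: sub_all => x /leq_trans; apply. Qed.

Lemma expect_far k n h : (0 < k)%N -> below k h ->
  expect n (fun h' => (~~ below (k + n) h')%:R) h = 0.
Proof.
move=> k0; elim: n k k0 h => [|n IH] k k0 h hb.
  by rewrite expect0 addn0 hb.
rewrite addnS -addSn expectS -[RHS](step_cst str b_gt0 0 h) /step.
have sx : (size (head [::] h) < k)%N by case: h hb => [|x h] // /andP[].
have below_cons (y : vertex) : (size y <= k)%N -> below k.+1 (y :: h).
  by move=> sy; rewrite /below /= ltnS sy; apply: below_leq hb.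
rewrite IH //; last first.
  by apply: below_cons; rewrite size_behead (leq_trans (leq_pred _)) // ltnW.
by congr avg; apply/funext => j; apply: IH => //; apply: below_cons.
Qed.

Hypothesis tail_divergence : forall A, exists n, A <= \sum_(i < n) tail i.
Hypothesis escape : forall j (eps : R), 0 < eps ->
  exists n, 1 - eps <= expect n (fun h => (~~ below j h)%:R) root.

Definition never_long K N h := `[< forall i, (N <= i)%N ->
    ~~ long i (K * i) h >].

Lemma never_long_cons K N y h : never_long K N (y :: h) -> never_long K N h.
Proof.
move=> /asboolP never; apply/asboolP => i Ni; apply: contra (never i Ni).
exact: long_cons.
Qed.

(** The histories from which the walk might fail to reach the level [j] have
    probability 0. *)
Let escape_at j n0 : expect n0 (fun h =>
  (`[< forall n, expect n (fun h' => (~~ below j h')%:R) h < 2^-1 >])%:R) root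
  <= 0.
Proof.
apply/ler_addgt0Pr => eps eps0; rewrite add0r.
have [n nP] := escape j (divr_gt0 eps0 (ltr0Sn R 1)).
have {nP} nP : 1 - eps / 2 <=
    expect n0 (expect n (fun h => (~~ below j h)%:R)) root.
  rewrite -expectD; apply: (le_trans nP).
  apply: expect_homo => // [y h|]; last exact: leq_addl.
  by apply: ler_indic; apply: contra => /andP[].
apply: (@le_trans _ _ (expect n0 (fun h =>
    2 * 1 + (- 2) * expect n (fun h' => (~~ below j h')%:R) h) root)).
  apply: expect_le => // h; case: asboolP => [/(_ n)|_] /=; first by lra.
  have : expect n (fun h' => (~~ below j h')%:R) h <= 1.
    rewrite -[leRHS](expect_cst str b_gt0 n _ h); apply: expect_le => // h'.
    by rewrite lern1 leq_b1.
  by lra.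
by rewrite expect_lin expect_cst //; lra.
Qed.

(** Whatever the walk has done so far, it has a fixed probability of making a
    long excursion above the levels that it has not reached yet. *)
Let never_long_contraction K N n0 : (0 < K)%N -> exists n,
  expect n (fun h => (never_long K N h)%:R) root <=
  (1 - (8 * K.+1%:R)^-1) * expect n0 (fun h => (never_long K N h)%:R) root.
Proof.
move=> K_gt0; set c : R := (8 * K.+1%:R)^-1.
(* At time [n0] no level from [n0.+1] on has been reached. *)
pose m := (N + n0).+1.
have [L S_large] := window_divergence b_gt0 str01 tail_divergence m
  (1 + 2 * K%:R * m%:R) K_gt0.
pose G h : R := (never_long K N h)%:R.
pose bad1 h := `[< forall n, expect n (fun h' => (~~ below (m + L) h')%:R) h
  < 2^-1 >].
have c1 : 0 <= 1 - c.
  rewrite subr_ge0 invf_le1 ?mulr_gt0 ?ltr0n // -natrM ler1n; lia.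
have [|m0 m0P] := @expect_uniform _ _ str str01 n0 (fun n => expect n G)
  (fun h => (1 - c) * G h + ((bad1 h)%:R + (~~ below m h)%:R)) root.
  move=> h.
  have G_le n : expect n G h <= 1.
    rewrite -[leRHS](expect_cst str b_gt0 n _ h); apply: expect_le => // h'.
    by rewrite /G lern1 leq_b1.
  have [hG|nG] := boolP (never_long K N h); last first.
    exists 0%N => n _; rewrite (_ : expect n G h = 0).
      by rewrite !addr_ge0 ?mulr_ge0.
    elim: n h nG {G_le} => [|n IH] h nG;
      first by rewrite expect0 /G (negbTE nG).
    rewrite expectS -[RHS](step_cst str b_gt0 0 h) /step; congr avg.
      by apply/funext => j; apply: IH; apply: contra nG; apply: never_long_cons.
    by apply: IH; apply: contra nG; apply: never_long_cons.
  have [hb|nb] := boolP (below m h); last first.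
    exists 0%N => n _; apply: (le_trans (G_le n)).
    by rewrite addrA lerDr addr_ge0 ?mulr_ge0.
  have [b1|/asboolPn nb1] := boolP (bad1 h).
    exists 0%N => n _; apply: (le_trans (G_le n)).
    by rewrite addr0 lerDr mulr_ge0.
  have {nb1} hit : exists n, 2^-1 <= expect n
      (fun h' => (~~ below (m + L) h')%:R) h.
    apply: contrapT => /forallNP nohit; apply: nb1 => n.
    by rewrite ltNge; apply/negP.
  have [n1 n1P] := long_excursion_prob b_gt0 str01 K_gt0 (ltn0Sn _) S_large hb
      hit.
  exists n1 => n n1n; rewrite !addr0 {2}/G hG mulr1.
  pose J h' : R := [exists k : 'I_L, long (m + k) (K * (m + k)) h']%:R.
  have {}n1P : c <= expect n J h.
    apply: (le_trans n1P); apply: expect_homo => // y h'; apply: ler_indic.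
    by move=> /existsP[k hk]; apply/existsP; exists k; apply: long_cons.
  apply: (@le_trans _ _ (expect n (fun h' => 1 * 1 + (- 1) * J h') h)).
    apply: expect_le => // h'; rewrite /G /J; case: existsP => [[k hk]|_].
      have -> : never_long K N h' = false.
        apply/negbTE/negP => /asboolP/(_ (m + k)%N); rewrite hk => never.
        by have := never _; rewrite /m addSn -addnS -addnA leq_addr => /(_ isT).
      by rewrite !mulr1 subrr.
    by rewrite mulr0 addr0 mulr1 lern1 leq_b1.
  by rewrite expect_lin expect_cst // mulN1r mul1r lerD2l lerN2.
exists (n0 + m0)%N; rewrite expectD; apply: (le_trans (m0P _ (leqnn _))).
rewrite expectD_fun expectZ expectD_fun -[leRHS]addr0 lerD2l.
rewrite -[leRHS](addr0 0) lerD //; first exact: escape_at.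
rewrite -(expect_far n0 (ltn0Sn 0) (isT : below 1 root)).
apply: expect_le => // h; apply: ler_indic; apply: contra; apply: below_leq.
by rewrite add1n /m ltnS leq_addl.
Qed.

Lemma never_long_vanish K N eps : (0 < K)%N -> 0 < eps ->
  exists n, expect n (fun h => (never_long K N h)%:R) root <= eps.
Proof.
move=> K_gt0 eps0; set r : R := 1 - (8 * K.+1%:R)^-1.
have K1 : 1 <= 8 * K.+1%:R :> R by rewrite -natrM ler1n; lia.
have r01 : 0 <= r < 1.
  rewrite subr_ge0 invf_le1 ?(lt_le_trans ltr01) // K1 /=.
  by rewrite gtrBl invr_gt0 (lt_le_trans ltr01).
have [k kP] := geometric_small 1 r01 eps0.
have [n nP] : exists n, expect n (fun h => (never_long K N h)%:R) root <=
    r ^+ k.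
  elim: (k) => [|j [n nP]].
    by exists 0%N; rewrite expect0 expr0 lern1 leq_b1.
  have [n' n'P] := never_long_contraction N n K_gt0; exists n'.
  apply: (le_trans n'P); rewrite exprS ler_wpM2l //.
  by case/andP: r01.
exists n; apply: (le_trans nP); have := kP k (leqnn k); rewrite mul1r.
exact: ltW.
Qed.

End NeverLong.

(** * The law of the walk *)

Section Law.
Variables (R : realType) (b : nat) (C : cookies R).
Variables (d : measure_display) (Omega : measurableType d).
Variables (P : probability Omega R) (X : nat -> {RV P >-> tree b}).
Hypothesis b_gt0 : (0 < b)%N.
Hypothesis walkX : is_cookie_walk C X.
Local Notation str := (cookie_strength C).
Local Notation history := (seq (seq 'I_b)).

Fixpoint past (x : nat -> seq 'I_b) n : history :=
  x n :: (if n is n'.+1 then past x n' else [::]).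

Definition hist n w : history := past (fun k => X k w) n.

Lemma past_eqP x y n :
  past x n = past y n <-> (forall k, (k <= n)%N -> x k = y k).
Proof.
elim: n => [|n IH] /=; split.
- by move=> [e] k; rewrite leqn0 => /eqP ->.
- by move=> e; rewrite e.
- by move=> [e /IH le] k; rewrite leq_eqVlt => /predU1P[->//|]; apply: le.
- move=> e; rewrite e //; congr cons; apply/IH => k kn.
  by apply: e; apply: leqW.
Qed.

Lemma visits_past (x : nat -> tree b) n :
  visits x n = count_mem (x n) (past x n).
Proof.
rewrite /visits -sum1dep_card; set y := x n; clearbody y.
elim: n => [|n IH].
  by rewrite big_mkcond big_ord_recl big_ord0 /= !addn0; case: eqP.
rewrite big_mkcond big_ord_recr /= -big_mkcond /= IH addnC.
by congr (_ + _)%N; case: eqP.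
Qed.

Lemma measurable_hist n (Q : set history) : measurable [set w | Q (hist n w)].
Proof.
elim: n Q => [|n IH] Q.
  exact: (measurable_funPTI (X 0%N) (Y := [set x | Q [:: x]])).
rewrite (_ : [set w | Q (hist n.+1 w)] = \bigcup_(y : tree b)
    ([set w | Q (y :: hist n w)] `&` X n.+1 @^-1` [set y])).
  apply: countable_bigcupT_measurable => [|y]; first exact: countableP.
  apply: measurableI; last exact: measurable_funPTI.
  exact: (IH [set h | Q (y :: h)]).
apply/seteqP; split => [w Qw|w [y _ [Qw /= e]]].
  by exists (X n.+1 w).
by rewrite /= /hist /= e.
Qed.

Lemma hist_step n h y : P ([set w | hist n w = h] `&` [set w | X n.+1 w = y]) =
  (P [set w | hist n w = h] *
   (step_prob C (count_mem (head [::] h) h) (head [::] h) y)%:E)%E.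
Proof.
have [[w0 w0h]|noh] := pselect (exists w, hist n w = h); last first.
  have -> : [set w | hist n w = h] = set0.
    by apply/seteqP; split => // w wh; apply: noh; exists w.
  by rewrite set0I measure0 mul0e.
have := walkX.2 n (fun k => X k w0) y; rewrite visits_past /=.
have -> : [set w | forall k, (k <= n)%N -> X k w = X k w0] =
    [set w | hist n w = h].
  by rewrite -w0h; apply/seteqP; split => w /=; rewrite /hist past_eqP.
have hE : head [::] h = X n w0 by rewrite -w0h /hist; case: (n).
by move=> ->; rewrite hE -w0h.
Qed.

Definition neighbour (x : seq 'I_b) (o : option 'I_b) : seq 'I_b :=
  if o is Some i then i :: x else behead x.

Lemma neighbour_inj x : injective (neighbour x).
Proof.
move=> [i|] [j|] //= => [[->]//| |] /eqP; last rewrite eq_sym.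
all: by rewrite son_neq_father.
Qed.

Lemma step_prob_son j (x : tree b) (i : 'I_b) :
  step_prob C j x (i :: x) = str j / b%:R.
Proof. by rewrite /step_prob ifT //; apply/existsP; exists i. Qed.

Lemma step_prob_father j (x : tree b) : step_prob C j x (behead x) = 1 - str j.
Proof.
rewrite /step_prob ifF; first by rewrite eqxx.
by apply/negbTE/existsPn => i; rewrite eq_sym son_neq_father.
Qed.

Let moves n h o : set Omega :=
  [set w | hist n w = h] `&` [set w | X n.+1 w = neighbour (head [::] h) o].

Let measurable_moves n h o : measurable (moves n h o).
Proof.
apply: measurableI; first exact: (measurable_hist n [set h]).
exact: (measurable_funPTI (X n.+1) (Y := [set _])).
Qed.

Let trivIset_moves n h : trivIset setT (moves n h).
Proof.
move=> o o' _ _ [w [[_ /= e] [_ /= e']]].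
by apply: (@neighbour_inj (head [::] h)); rewrite -e.
Qed.

Let P_split n h (E : set Omega) : measurable E ->
  (P E = P (E `&` \bigcup_o moves n h o) + P (E `\` \bigcup_o moves n h o))%E.
Proof.
move=> mE; have mU : measurable (\bigcup_o moves n h o).
  by apply: countable_bigcupT_measurable => //; apply: countableP.
by rewrite addeC -measureDI.
Qed.

Let P_moves n h (E : set Omega) : measurable E ->
  (P (E `&` \bigcup_o moves n h o) =
    \sum_(i < b) P (E `&` moves n h (Some i)) + P (E `&` moves n h None))%E.
Proof.
move=> mE; have mEm o : measurable (E `&` moves n h o) by apply: measurableI.
pose F i := E `&` moves n h (Some i).
have FE : \bigcup_i F i = \big[setU/set0]_(i < b) F i.
  rewrite -(bigcup_seq (index_enum 'I_b) F); apply/seteqP.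
  by split=> w [i _ Fw]; exists i => //=; rewrite mem_index_enum.
have triv : trivIset setT (fun o => E `&` moves n h o).
  move=> o o' oT o'T [w [[_ m1] [_ m2]]].
  by apply: (@trivIset_moves n h) => //; exists w.
have -> : E `&` \bigcup_o moves n h o =
    \big[setU/set0]_(i < b) F i `|` (E `&` moves n h None).
  rewrite -FE; apply/seteqP; split => [w [Ew [[i|] _ mw]]|w].
  - by left; exists i.
  - by right.
  - by case=> [[i _ [Ew mw]]|[Ew mw]]; split=> //;
    [exists (Some i)|exists None].
rewrite measureU //.
- congr (_ + _)%E; apply: measure_bigsetU_ord => [i|i j _ _ [w [Fi Fj]]].
    exact: mEm.
  by have [] : Some i = Some j by apply: triv => //; exists w.
- rewrite -FE; apply: countable_bigcupT_measurable => [|i]; last exact: mEm.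
  exact: countableP.
- rewrite -FE -subset0 => w [[i _ Fi] Ew].
  by have [] : Some i = None by apply: triv => //; exists w.
Qed.

Let step_prob_moves n h o : P (moves n h o) = (P [set w | hist n w = h] *
  (if o is Some i then str (count_mem (head [::] h) h) / b%:R
   else 1 - str (count_mem (head [::] h) h))%:E)%E.
Proof.
rewrite /moves hist_step; case: o => [i|]; rewrite ?step_prob_son //.
by rewrite step_prob_father.
Qed.

Let P_hist_split n h (E : set Omega) : measurable E ->
  E `<=` [set w | hist n w = h] ->
  P E = (\sum_(i < b) P (E `&` moves n h (Some i)) +
    P (E `&` moves n h None))%E.
Proof.
move=> mE sub; rewrite (P_split n h mE) P_moves //.
set A := [set w | hist n w = h] in sub *.
have mA : measurable A by exact: (measurable_hist n [set h]).
have mU : measurable (\bigcup_o moves n h o).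
  by apply: countable_bigcupT_measurable => //; apply: countableP.
have restA : P (A `\` \bigcup_o moves n h o) = 0%E.
  have mr : measurable (A `\` \bigcup_o moves n h o) by apply: measurableD.
  have := P_split n h mA; rewrite P_moves //.
  have AI o : A `&` moves n h o = moves n h o by rewrite setIA setIid.
  under eq_bigr => i _ do rewrite AI step_prob_moves.
  rewrite AI step_prob_moves -/A.
  rewrite -[P A]fineK ?fin_num_measure // -[X in (_ + X)%E]fineK
      ?fin_num_measure //.
  rewrite -EFinM sumEFin -!EFinD => -[]; set a := fine (P A).
  rewrite sumr_const card_ord -[_ *+ b]mulr_natl.
  set p := str _ => e; rewrite -[LHS]fineK ?fin_num_measure //; congr EFin.
  have b0 : b%:R != 0 :> R by rewrite pnatr_eq0 -lt0n.
  have : b%:R * (a * (p / b%:R)) + a * (1 - p) = a by field.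
  by move: e; lra.
rewrite [X in (_ + X)%E](_ : _ = 0%E) ?adde0 //; apply/eqP.
rewrite -measure_le0 -restA le_measure ?inE //; first exact: measurableD.
  exact: measurableD.
exact: setSD.
Qed.

(** The probabilities of the jumps to the neighbours add up to 1, so all other
    jumps have probability 0 and only the neighbours contribute to [expect]. *)
Lemma hist_law n m h (Q : set history) :
  P ([set w | hist n w = h] `&` [set w | Q (hist (n + m) w)]) =
  (P [set w | hist n w = h] *
   (expect str m (fun h' => (`[< Q h' >])%:R) h)%:E)%E.
Proof.
elim: m n h => [|m IH] n h.
  rewrite addn0 expect0; case: asboolP => [Qh|nQ].
    rewrite mule1; congr (P _); apply/seteqP; split => [w []//|w /= wh].
    by rewrite wh.
  rewrite mule0 (_ : _ `&` _ = set0) ?measure0 // -subset0 => w [/= ->].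
  by [].
set A := [set w | hist n w = h]; set B := [set w | Q (hist (n + m.+1) w)].
have mA : measurable A by exact: (measurable_hist n [set h]).
have mB : measurable B by exact: measurable_hist.
rewrite (@P_hist_split n h (A `&` B) (measurableI _ _ mA mB) (@subIsetl _ A B)).
have movesE o : A `&` B `&` moves n h o =
    [set w | hist n.+1 w = neighbour (head [::] h) o :: h] `&`
    [set w | Q (hist (n.+1 + m) w)].
  rewrite addSnnS; apply/seteqP;
    split => [w [[_ Bw] [/= e1 e2]]|w [/= [e1 e2] Bw]].
    by split => //=; rewrite /hist /= -/(hist n w) e1 e2.
  by split; split.
have moves1 o : [set w | hist n.+1 w = neighbour (head [::] h) o :: h] =
    moves n h o.
  apply/seteqP; split => [w /= [e1 e2]|w [/= e1 e2]]; first by split.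
  by rewrite /hist /= -/(hist n w) e1 e2.
under eq_bigr => i _ do rewrite movesE IH moves1 step_prob_moves -/A.
rewrite movesE IH moves1 step_prob_moves -/A.
rewrite -[P A]fineK ?fin_num_measure // -!EFinM sumEFin -EFinD; congr EFin.
rewrite expectS /step /avg; set p := str _; set a := fine _.
under eq_bigr => i _ do rewrite -mulrA.
by rewrite -!mulr_sumr /=; ring.
Qed.

Lemma prob_hist m (Q : set history) :
  P [set w | Q (hist m w)] =
  (expect str m (fun h' => (`[< Q h' >])%:R) (root_history b))%:E.
Proof.
have hist0 : [set w | hist 0 w = root_history b] = setT.
  by apply/seteqP; split => // w _ /=; rewrite /hist /= walkX.1.
by have := hist_law 0 m (root_history b) Q;
  rewrite hist0 setTI probability_setT mul1e.
Qed.

Lemma prob_eventually (Q : set history) (eps : R) :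
  (forall y h, Q h -> Q (y :: h)) ->
  (forall n, expect str n (fun h => (`[< Q h >])%:R) (root_history b) <= eps) ->
  (P [set w | exists n, Q (hist n w)] <= eps%:E)%E.
Proof.
move=> Qcons Qeps.
have mQ n : measurable [set w | Q (hist n w)] by apply: measurable_hist.
rewrite (_ : [set w | _] = \bigcup_n [set w | Q (hist n w)]); last first.
  by apply/seteqP; split => [w [n Qn]|w [n _ Qn]]; exists n.
have Qmono w k n : (k <= n)%N -> Q (hist k w) -> Q (hist n w).
  move=> kn; rewrite -(subnK kn); elim: (n - k)%N => [//|j IH] Qk.
  by rewrite addSn; apply: Qcons; apply: IH.
have cv : (P \o (fun n => [set w | Q (hist n w)])) @ \oo -->
    P (\bigcup_n [set w | Q (hist n w)]).
  apply: nondecreasing_cvg_mu => //.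
    exact: bigcupT_measurable.
  by move=> k n kn; apply/subsetPset => w; apply: Qmono.
rewrite -(cvg_lim _ cv) //; apply: lime_le; first by apply/cvg_ex; eexists;
  apply: cv.
by apply: nearW => n /=; rewrite prob_hist lee_fin.
Qed.

Lemma prob_always (Q : set history) (eps : R) :
  (forall y h, Q (y :: h) -> Q h) ->
  (forall n, eps <= expect str n (fun h => (`[< Q h >])%:R) (root_history b)) ->
  (eps%:E <= P [set w | forall n, Q (hist n w)])%E.
Proof.
move=> Qcons Qeps.
have Qmono w k n : (k <= n)%N -> Q (hist n w) -> Q (hist k w).
  move=> kn; rewrite -(subnK kn); elim: (n - k)%N => [//|j IH].
  by rewrite addSn => /Qcons.
rewrite (_ : [set w | _] = \bigcap_n [set w | Q (hist n w)]); last first.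
  by apply/seteqP; split => [w Qw n _|w Qw n]; apply: Qw.
have mQ n : measurable [set w | Q (hist n w)] by apply: measurable_hist.
have cv : (P \o (fun n => [set w | Q (hist n w)])) @ \oo -->
    P (\bigcap_n [set w | Q (hist n w)]).
  apply: nonincreasing_cvg_mu => //.
  - by rewrite (le_lt_trans (probability_le1 P (mQ 0%N))) // ltry.
  - exact: bigcapT_measurable.
  - by move=> k n kn; apply/subsetPset => w; apply: Qmono.
rewrite -(cvg_lim _ cv) //; apply: lime_ge; first by apply/cvg_ex; eexists;
  apply: cv.
by apply: nearW => n /=; rewrite prob_hist lee_fin.
Qed.

Let negligible_of_le (A : set Omega) : measurable A ->
  (forall eps : R, 0 < eps -> (P A <= eps%:E)%E) -> P.-negligible A.
Proof.
move=> mA Aeps; apply/negligibleP => //; apply/eqP; rewrite -measure_le0.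
by apply/lee_addgt0Pr => eps eps0; rewrite add0e; apply: Aeps.
Qed.

Lemma ae_bounded (Q : nat -> set history) :
  (forall k y h, Q k h -> Q k (y :: h)) ->
  (forall eps : R, 0 < eps -> exists k, forall n,
    expect str n (fun h => (`[< Q k h >])%:R) (root_history b) <= eps) ->
  {ae P, forall w, exists k, forall n, ~ Q k (hist n w)}.
Proof.
move=> Qcons Qeps.
change (P.-negligible (~` [set w | exists k, forall n, ~ Q k (hist n w)])).
have -> : ~` [set w | exists k, forall n, ~ Q k (hist n w)] =
    \bigcap_k \bigcup_n [set w | Q k (hist n w)].
  apply/seteqP; split => [w /= nex k _|w /= ex [k kP]].
    have /existsNP[n /contrapT Qn] := (forallNP _).2 nex k.
    by exists n.
  by have [n _ Qn] := ex k I; apply: (kP n).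
have mU k : measurable (\bigcup_n [set w | Q k (hist n w)]).
  by apply: bigcupT_measurable => n; apply: measurable_hist.
apply: negligible_of_le => [|eps eps0]; first exact: bigcapT_measurable.
have [k kP] := Qeps eps eps0.
apply: le_trans (prob_eventually (Qcons k) kP); apply: le_measure; rewrite ?inE.
- exact: bigcapT_measurable.
- rewrite (_ : [set w | _] = \bigcup_n [set w | Q k (hist n w)]) //.
  by apply/seteqP; split => [w [n Qn]|w [n _ Qn]]; exists n.
- by move=> w /(_ k I)[n _ Qn]; exists n.
Qed.

Lemma ae_exists_not (Q : set history) :
  (forall eps : R, 0 < eps -> exists n,
    expect str n (fun h => (`[< Q h >])%:R) (root_history b) <= eps) ->
  {ae P, forall w, exists n, ~ Q (hist n w)}.
Proof.
move=> Qeps; change (P.-negligible (~` [set w | exists n, ~ Q (hist n w)])).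
have -> : ~` [set w | exists n, ~ Q (hist n w)] =
    \bigcap_n [set w | Q (hist n w)].
  apply/seteqP; split => [w /= nex n _|w /= ex [n nP]];
    last exact: (nP (ex n I)).
  exact: contrapT ((forallNP _).2 nex n).
have mQ n : measurable [set w | Q (hist n w)] by apply: measurable_hist.
apply: negligible_of_le => [|eps eps0]; first exact: bigcapT_measurable.
have [n nP] := Qeps eps eps0.
apply: (@le_trans _ _ (P [set w | Q (hist n w)])).
  apply: le_measure; rewrite ?inE //; first exact: bigcapT_measurable.
  by move=> w /(_ n I).
by rewrite prob_hist lee_fin.
Qed.

End Law.

(** * Sample paths *)

Section Paths.
Variable b : nat.
Implicit Types (x : nat -> seq 'I_b) (h : seq (seq 'I_b)).

Lemma size_past x n : size (past x n) = n.+1.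
Proof. by elim: n => [|n IH] //=; rewrite IH. Qed.

Lemma visits_past_leq i x m n : (m <= n)%N ->
  (visits_to_level i (past x m) <= visits_to_level i (past x n))%N.
Proof.
move=> mn; rewrite -(subnK mn); elim: (n - m)%N => [//|k IH].
by rewrite addSn (leq_trans IH) // /visits_to_level /= leq_addl.
Qed.

Lemma levels_escape x :
  (forall i, exists r, forall n, ~ (r <= visits_to_level i (past x n))%N) ->
  forall H, exists N, forall n, (N <= n)%N -> (H <= size (x n))%N.
Proof.
move=> bounded; elim=> [|H [N NP]]; first by exists 0%N.
suff [N' N'P] : exists N', forall n, (N' <= n)%N -> size (x n) <> H.
  exists (maxn N N') => n; rewrite geq_max => /andP[/NP + /N'P/eqP nH].
  by rewrite leq_eqVlt eq_sym (negbTE nH).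
apply: contrapT => /forallNP often.
have [r rP] := bounded H.
suff many k : exists n, (k <= visits_to_level H (past x n))%N.
  by have [n /rP] := many r.
elim: k => [|k [n nP]]; first by exists 0%N.
have /existsNP[n' /not_implyP[nn' /contrapT sH]] := often n.+1.
exists n'; case: n' nn' sH => // n'; rewrite ltnS => nn' sH.
rewrite /visits_to_level /= sH eqxx add1n ltnS.
exact: leq_trans nP (visits_past_leq _ _ nn').
Qed.

Lemma long_past i s x n : long i s (past x n) ->
  exists2 k, (k <= n)%N & run i (past x k) = Some s.
Proof.
elim: n => [|n IH]; rewrite [long _ _ _]/=.
  by rewrite orbF => /eqP; exists 0%N.
case/orP => [/eqP|/IH[k kn ?]]; first by exists n.+1.
by exists k => //; apply: leqW.
Qed.

Lemma run_lt_size i h t : run i h = Some t -> (t < size h)%N.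
Proof.
elim: h t => [//|y h IH] t /=; case e: (run i h) => [t'|]; case: ifP => //.
  by move=> _ [<-]; rewrite ltnS IH.
by move=> _ [<-].
Qed.

(** When an excursion above the level [i] that has lasted more than [K * i]
    steps comes to its end, the walk is back at a level below [i]. *)
Lemma slow_times x :
  (forall K N, (0 < K)%N -> exists n, ~ never_long K N (past x n)) ->
  (forall i, (0 < i)%N -> exists s, forall n, ~ long i s (past x n)) ->
  forall K N, (0 < K)%N -> exists2 n, (N < n)%N & (K * size (x n) <= n)%N.
Proof.
move=> often finite K N K_gt0.
have [n never] := often K N.+1 K_gt0.
have /existsNP[i /not_implyP[Ni /negP/negPn]] :
    ~ forall i, (N < i)%N -> ~~ long i (K * i) (past x n).
  by move=> all_short; apply/never/asboolP.
have i_gt0 : (0 < i)%N by apply: leq_trans Ni.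
move=> /long_past[k kn run_k]; have [s sP] := finite i i_gt0.
have [j run_j over] : exists2 j, run i (past x (k + j)) = Some (K * i + j)%N &
    run i (past x (k + j).+1) = None.
  apply: contrapT => nover.
  have run_on j : run i (past x (k + j)) = Some (K * i + j)%N.
    elim: j => [|j IH]; first by rewrite !addn0.
    case: (pselect (run i (past x (k + j).+1) = None)) => [over|].
      by case: nover; exists j.
    rewrite !addnS [run _ _]/= IH; by case: ifP.
  apply: (sP (k + s)%N); apply: (@longW _ _ s (K * i + s)).
    exact: leq_addl.
  exact: run_Some_long.
have time : (K * i <= k + j)%N.
  by have := run_lt_size run_j; rewrite size_past ltnS; apply: leq_trans;
    rewrite leq_addr.
exists (k + j).+1.
  by rewrite ltnS (leq_trans _ time) // (leq_trans (ltnW Ni)) // leq_pmull.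
move: over; rewrite [run _ _]/= run_j; case: ltnP => // lt_i _.
by rewrite leqW // (leq_trans _ time) // leq_mul2l ltnW ?orbT.
Qed.

End Paths.

Lemma limn_einf_ratio (R : realType) (a : nat -> nat) :
  (forall K N, (0 < K)%N -> exists2 n, (N < n)%N & (K * a n <= n)%N) ->
  limn_einf (fun n => ((a n)%:R / n%:R : R)%:E) = 0%E.
Proof.
move=> slow; set u := fun n => _; rewrite limn_einf_lim.
suff -> : einfs u = cst 0%E by apply: lim_cst.
apply/funext => N; apply/eqP; rewrite eq_le; apply/andP; split; last first.
  by apply: le_ereal_inf_tmp => _ [n _ <-]; rewrite lee_fin divr_ge0.
apply/lee_addgt0Pr => eps eps0; rewrite add0e.
have [n Nn slow_n] := slow (Num.trunc eps^-1).+1 N (ltn0Sn _).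
apply: (@le_trans _ _ (u n)).
  by apply: ereal_inf_lbound; exists n => //=; apply: ltnW.
have n_gt0 : (0 : R) < n%:R by rewrite ltr0n (leq_trans _ Nn).
rewrite lee_fin ler_pdivrMr // -ler_pdivrMl //.
apply: (@le_trans _ _ ((Num.trunc eps^-1).+1%:R * (a n)%:R)).
  by apply: ler_wpM2r => //; apply: ltW; apply: truncnS_gt.
by rewrite -natrM ler_nat.
Qed.

(** * Transience and slow times *)

Section CookieWalk.
Variables (R : realType) (b : nat) (C : cookies R).
Hypothesis b_gt1 : (1 < b)%N.
Hypothesis envC : is_cookie_env C.
Local Notation str := (cookie_strength C).

Lemma cookie_strength_in j : str j \in rcons (cookie_seq C) (cookie_end C).
Proof.
rewrite mem_rcons inE /cookie_strength.
have [lt_j|le_j] := ltnP j.-1 (size (cookie_seq C)).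
  by rewrite mem_nth ?orbT.
by rewrite nth_default ?eqxx.
Qed.

Lemma cookie_strength_bound j : 0 <= str j < 1.
Proof.
have := cookie_strength_in j; rewrite mem_rcons inE => /predU1P[->|].
  by case: envC => _ _ /andP[/ltW -> ->].
by case: envC => _ + _ => /[apply].
Qed.

Lemma cookie_strength01 j : 0 <= str j <= 1.
Proof. by have /andP[-> /ltW ->] := cookie_strength_bound j. Qed.

Lemma cookie_strength_le : exists2 alpha, 0 <= alpha < 1 &
  forall j, str j <= alpha.
Proof.
suff [alpha alpha01 alphaP] : exists2 alpha, 0 <= alpha < 1 &
    forall p, p \in rcons (cookie_seq C) (cookie_end C) -> p <= alpha.
  by exists alpha => // j; apply/alphaP/cookie_strength_in.
have : forall p, p \in rcons (cookie_seq C) (cookie_end C) -> p < 1.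
  move=> p; rewrite mem_rcons inE => /predU1P[->|].
    by case: envC => _ _ /andP[].
  by case: envC => _ + _ => /[apply] /andP[].
elim: (rcons _ _) => [|p s IH] lt1; first by exists 0; rewrite ?lexx ?ltr01.
have [|alpha /andP[alpha0 alpha1] alphaP] := IH.
  by move=> p' p's; apply: lt1; rewrite inE p's orbT.
exists (Num.max p alpha).
  by rewrite le_max alpha0 orbT gt_max alpha1 lt1 // mem_head.
move=> p'; rewrite inE le_max => /predU1P[->|/alphaP ->]; first by rewrite lexx.
by rewrite orbT.
Qed.

Variables (d : measure_display) (Omega : measurableType d).
Variables (P : probability Omega R) (X : nat -> {RV P >-> tree b}).
Hypothesis walkX : is_cookie_walk C X.
Hypothesis end_large : b%:R / (b%:R + 1) <= cookie_end C.

Let b_gt0 : (0 < b)%N. Proof. exact: ltnW. Qed.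

Lemma ae_levels : {ae P, forall w, forall i, exists r, forall n,
  ~ (r <= visits_to_level i (hist X n w))%N}.
Proof.
have q_large : 1 - cookie_end C <= cookie_end C / b%:R.
  rewrite ler_pdivlMr ?ltr0n // mulrBl mul1r lerBlDr addrC.
  by rewrite -[X in _ <= _ + X]mulr1 -mulrDr -ler_pdivrMr // ltr_wpDl.
have str_end j : (size (cookie_seq C) < j)%N -> str j = cookie_end C.
  by case: j => // j; rewrite ltnS => le_j;
    rewrite /cookie_strength nth_default.
have [alpha alpha01 str_le] := cookie_strength_le.
apply: ae_foralln => i.
apply: (ae_bounded b_gt0 walkX
  (Q := fun r h => (r <= visits_to_level i h)%N)) => [r y h|eps eps0].
  by move=> /leq_trans; apply; rewrite /visits_to_level /= leq_addl.
have tight0 : tight str (@downs b 0).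
  apply: tight_downs0 => //; first exact: cookie_strength01.
  exact: exck_vanish cookie_strength01 str_end q_large.
have [r rP] := tight_levels b_gt0 cookie_strength01 i alpha01 str_le tight0
    eps0.
exists r => n; apply: le_trans (rP n); apply: expect_le => [|h].
  exact: cookie_strength01.
by rewrite asboolb.
Qed.

(** Every level is visited finitely often, hence eventually left behind. *)
Theorem cookie_walk_transient : is_transient X.
Proof.
apply: filterS ae_levels => w /levels_escape escape.
apply/cvgnyPge => H; have [N NP] := escape H.
by exists N => // n /= /NP.
Qed.

Lemma cookie_walk_escape j (eps : R) : 0 < eps ->
  exists n, 1 - eps <=
    expect str n (fun h => (~~ below j h)%:R) (root_history b).
Proof.
move=> eps0; apply: contrapT => /forallNP stuck.
have below_ge n : eps <= expect str n (fun h => (`[< below j h >])%:R)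
    (root_history b).
  have -> : expect str n (fun h => (`[< below j h >])%:R) (root_history b) =
      expect str n (fun h => 1 * 1 + (- 1) * (~~ below j h)%:R)
        (root_history b).
    by congr expect; apply/funext => h; rewrite asboolb; case: below => /=;
      ring.
  rewrite expect_lin expect_cst //; have /negP := stuck n; rewrite -ltNge.
  by move: (expect _ _ _ _) => x; lra.
have below_cons (y : seq 'I_b) h : below j (y :: h) -> below j h by case/andP.
have := @prob_always _ _ _ _ _ _ _ b_gt0 walkX (below j) eps below_cons
    below_ge.
rewrite (_ : P _ = 0%E) ?lee_fin ?leNgt ?eps0 //.
have mB : measurable [set w | forall n, below j (hist X n w)].
  rewrite (_ : [set w | _] = \bigcap_n [set w | below j (hist X n w)]).
    by apply: bigcapT_measurable => n; exact: (measurable_hist X n (below j)).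
  by apply/seteqP; split => [w Bw n _|w Bw n]; apply: Bw.
apply/negligibleP => //; apply: negligibleS ae_levels => w /= Bw esc.
have [N NP] := levels_escape esc j.
have : (size (X N w) < j)%N by case: N (Bw N) {NP} => [|N] /andP[].
by rewrite ltnNge NP.
Qed.

End CookieWalk.

(** [nu_matrix] gives the mean numbers of visits of each type to a given son,
    for one and two visits to its father; as there are [b] sons, the eigenvalue
    [1 / b] is the criticality of the branching process. *)
Lemma nu_matrix_critical (R : realType) (b : nat) (p1 p2 : R) : (0 < b)%N ->
  eigenvalue (nu_matrix b p1 p2) (1 / b%:R) ->
  p1 * (1 - p2) + p1 * p2 / b%:R * (1 + p2 - p1 * p2) +
    2 * (p1 * p2 * (1 - b%:R^-1)) = 1.
Proof.
move=> b_gt0 /eigenvalueP[v /matrixP ev v0].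
have b0 : b%:R != 0 :> R by rewrite pnatr_eq0 -lt0n.
have v_neq0 : (v 0 0 != 0) || (v 0 1 != 0).
  apply: contraNT v0; rewrite negb_or !negbK => /andP[/eqP v00 /eqP v01].
  apply/eqP/matrixP => i j; rewrite !mxE (ord1 i).
  have [->|->] : j = 0 \/ j = 1; rewrite ?v00 ?v01 //.
  by case: j => [[|[|]]] // lt_j; [left|right]; apply: val_inj.
have := ev 0 0; have := ev 0 1; rewrite !mxE !big_ord_recr !big_ord0 /= !add0r.
rewrite !mxE /=.
rewrite (_ : widen_ord _ _ = 0 :> 'I_2); last exact: val_inj.
rewrite (_ : ord_max = 1 :> 'I_2); last exact: val_inj.
move: (b%:R : R) b0 (v 0 0) (v 0 1) v_neq0 => B B0 u0 u1 u_neq0 e1 e0.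
pose A00 := p1 / B + p1 * p2 / B - 2 * p1 * p2 / B ^+ 2.
pose A10 := (p1 + p2) / B - 2 * p1 * p2 / B ^+ 2.
pose A11 := p1 * p2 / B ^+ 2.
rewrite -/A00 -/A10 -/A11 in e0 e1.
pose det := (A00 - 1 / B) * (A11 - 1 / B) - A11 * A10.
have det0 : det * u0 = 0.
  have -> : det * u0 = (A11 - 1 / B) * (u0 * A00 + u1 * A10 - 1 / B * u0) -
      A10 * (u0 * A11 + u1 * A11 - 1 / B * u1) by rewrite /det; ring.
  by rewrite e0 e1 !subrr !mulr0 subrr.
have det1 : det * u1 = 0.
  have -> : det * u1 = (A00 - 1 / B) * (u0 * A11 + u1 * A11 - 1 / B * u1) -
      A11 * (u0 * A00 + u1 * A10 - 1 / B * u0) by rewrite /det; ring.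
  by rewrite e0 e1 !subrr !mulr0 subrr.
have {det0 det1} detE : det = 0.
  by case/orP: u_neq0 => /mulIf; apply; rewrite mul0r.
apply/eqP; rewrite -subr_eq0; apply/eqP.
transitivity (- B ^+ 2 * det); last by rewrite detE mulr0.
by rewrite /det /A00 /A10 /A11; field.
Qed.

Theorem proposition1p9 (R : realType) (b : nat) (hb : (2 <= b)%N)
    (p1 p2 q : R)
    (hC : is_cookie_env (Cookies [:: p1; p2; 0; 0] q))
    (d : measure_display) (Omega : measurableType d) (P : probability Omega R)
    (X : nat -> {RV P >-> tree b})
    (hX : is_cookie_walk (Cookies [:: p1; p2; 0; 0] q) X)
    (hq : b%:R / (b%:R + 1) <= q)
    (hnu : is_largest_positive_eigenvalue (nu_matrix b p1 p2) (1 / b%:R)) :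
  is_transient X /\
  {ae P, forall w,
    limn_einf (fun n : nat => ((height (X n w))%:R / n%:R : R)%:E) = 0%E}.
Proof.
have hb0 : (0 < b)%N by apply: ltnW.
set C := Cookies _ q in hC hX.
have str01 := cookie_strength01 hC.
have transX : is_transient X by apply: cookie_walk_transient hX hq.
split => //.
have [_ p_lt1 _] := hC.
have p1_lt1 : p1 < 1 by have /andP[] := p_lt1 p1 (mem_head _ _).
have p2_lt1 : p2 < 1.
  by have /andP[] : 0 <= p2 < 1; first by apply: p_lt1; rewrite !inE eqxx orbT.
have critical := nu_matrix_critical hb0 (let: And3 _ e _ := hnu in e).
pose str := cookie_strength C.
have extinction := @critical_extinction R b str hb str01 erefl erefl
  p1_lt1 critical.
have divergence := @critical_tail_divergence R b str hb str01 erefl erefl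
  p1_lt1 p2_lt1 critical.
have often : {ae P, forall w, forall K N, (0 < K)%N ->
    exists n, ~ never_long K N (hist X n w)}.
  apply: ae_foralln => K; apply: ae_foralln => N.
  case: K => [|K]; first by apply: aeW => w.
  have ex_n : {ae P, forall w, exists n, ~ never_long K.+1 N (hist X n w)}.
    apply: (ae_exists_not hb0 hX (Q := fun h => never_long K.+1 N h)).
    move=> eps eps0.
    have [n nP] := never_long_vanish hb0 str01 divergence
      (cookie_walk_escape hb hC hX hq) N (ltn0Sn K) eps0.
    by exists n; apply: le_trans nP; apply: expect_le => // h; rewrite asboolb.
  by apply: filterS ex_n => w ex _.
have finite : {ae P, forall w, forall i, (0 < i)%N ->
    exists s, forall n, ~ long i s (hist X n w)}.
  apply: ae_foralln => -[|i]; first by apply: aeW => w.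
  have ex_s : {ae P, forall w, exists s, forall n, ~ long i.+1 s (hist X n w)}.
    apply: (ae_bounded hb0 hX (Q := fun s h => long i.+1 s h)) => [s y h|eps
        eps0].
      exact: long_cons.
    have [s sP] := extinction eps eps0; exists s => n.
    apply: le_trans (ltW sP).
    have below_root : below i.+1 (root_history b) by [].
    apply: le_trans (expect_long1 hb0 str01 s n (ltn0Sn i) below_root).
    by apply: expect_le => // h; rewrite asboolb.
  by apply: filterS ex_s => w ex _.
apply: filterS (filterI often finite) => w [often_w finite_w].
exact/limn_einf_ratio/slow_times.
Qed.
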